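(* Let $(G,E)$ be a connected simple graph with countably infinite vertex set and bounded degree, and $\mu$ a conductance on $E$ such that $(G,\mu)$ satisfies condition $(p_0)$ and $\mu$ satisfies $(\mathrm{VD})_R$, where $R$ is the effective resistance. If $\mathrm{diam}(G,R)=\infty$ and $V_R(x,s)<\infty$ for all $s>0$ and $x\in G$, then there exists a metric $d$ on $G$ that fits to $(G,E)$, is quasisymmetric to $R$, satisfies $d(x,y)\asymp1$ for $(x,y)\in E$, and for some $1\le\alpha<\beta$ satisfies: (DHK($\beta$)) $h_{2n}(x,x)\asymp 1/V_d(x,n^{1/\beta})$ for all $x\in G$, $n\ge1$; (ARL($\beta$)) there are $\lambda,C>0$ with $R(B_d(x,\lambda s),B_d(x,s)^c)V_d(x,s)\ge Cs^\beta$ for all $x$ and $s>r_x$; (BRU($\beta$)) there is $C'>0$ with $R(x,B_d(x,s)^c)V_d(x,s)\le C's^\beta$ for all $x$ and $s>r_x$; (VG($\alpha$)) there is $C''>0$ with $V_d(x,s)\le C''(s/t)^\alpha V_d(x,t)$ for all $x\in G$ and $s>t>0$.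
   Context: $\mu:E\to(0,\infty)$ symmetric; $\mu_x=\sum_{y\sim x}\mu_{xy}$, $\mu(A)=\sum_{x\in A}\mu_x$; $V_\rho(x,s)=\mu(B_\rho(x,s))$ for a metric $\rho$, $r_x=\inf_{y\ne x}d(x,y)$. Condition $(p_0)$: there is $p_0>0$ with $\mu_{xy}/\mu_x\ge p_0$ for all $x\sim y$. $(\mathrm{VD})_\rho$: there is $C>0$ with $V_\rho(x,2s)\le CV_\rho(x,s)$ for all $x$, $s>0$. Heat kernel: $p(x,y)=\mu_{xy}/\mu_x$, $p_n$ the $n$-step transition probabilities, $h_n(x,y)=p_n(x,y)/\mu_y$. Energy $\mathcal{E}(f)=\frac12\sum_{(x,y)\in E}(f(x)-f(y))^2\mu_{xy}$; $R(A,B)=(\inf\{\mathcal{E}(f):f|_A=1,f|_B=0\})^{-1}$, $R(x,y)=R(\{x\},\{y\})$ (a metric). Quasisymmetry: $d$ is quasisymmetric to $\rho$ if there is a homeomorphism $\theta$ of $[0,\infty)$ with $\rho(x,y)/\rho(x,z)\le\theta(d(x,y)/d(x,z))$ for all $x\ne z$. Fitting: (F1) there is $C>0$ with $d(x,y)\le Cd(x,z)$ whenever $x\sim y$, $x\ne z$; (F2) for every $\epsilon>0$ there exist $s>0$, $n\ge1$, $x_0,\dots,x_n$ with $x_i\in B_d(x_0,s)$ for $i<n$, $x_n\notin B_d(x_0,s)$, $x_i\sim x_{i-1}$, $d(x_i,x_{i-1})\le\epsilon s$. *)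

(* Defs.v *)
From HB Require Import structures.
From mathcomp Require Import all_boot all_order all_algebra.
From mathcomp Require Import all_classical all_reals all_analysis.
Set Implicit Arguments. Unset Strict Implicit. Unset Printing Implicit Defensive.
Import Order.TTheory GRing.Theory Num.Theory.
Import numFieldNormedType.Exports.
Local Open Scope classical_set_scope.
Local Open Scope ring_scope.

(* A graph on the vertex type V is given by its neighbour lists nb : V -> seq V;
   x ~ y  iff  y \in nb x. *)
Definition adj (V : eqType) (nb : V -> seq V) : rel V := fun x y => y \in nb x.

Definition simple_graph (V : eqType) (nb : V -> seq V) : Prop :=
  (forall x, uniq (nb x)) /\ (forall x, x \notin nb x) /\
  (forall x y, (y \in nb x) = (x \in nb y)).
Definition connected_graph (V : eqType) (nb : V -> seq V) : Prop :=
  forall x y : V, exists p : seq V, path (adj nb) x p /\ last x p = y.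
Definition bounded_degree (V : eqType) (nb : V -> seq V) : Prop :=
  exists M : nat, forall x, (size (nb x) <= M)%N.

Definition conductance (R : realType) (V : eqType) (nb : V -> seq V)
  (mu : V -> V -> R) : Prop :=
  forall x y, adj nb x y -> 0 < mu x y /\ mu x y = mu y x.

Section Defs.
Context (R : realType) (V : countType) (nb : V -> seq V) (mu : V -> V -> R).

Definition muv (x : V) : R := \sum_(y <- nb x) mu x y.

Definition muset (A : set V) : \bar R := (\esum_(x in A) (muv x)%:E)%E.

Definition ball_m (rho : V -> V -> R) (x : V) (s : R) : set V :=
  [set y | rho x y < s].

Definition vol (rho : V -> V -> R) (x : V) (s : R) : \bar R :=
  muset (ball_m rho x s).

Definition rmin (d : V -> V -> R) (x : V) : R := inf [set d x y | y in [set y | y != x]].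

Definition is_metric (d : V -> V -> R) : Prop :=
  (forall x y, 0 <= d x y) /\ (forall x y, d x y = 0 <-> x = y) /\
  (forall x y, d x y = d y x) /\ (forall x y z, d x z <= d x y + d y z).

Definition cond_p0 : Prop :=
  exists p0 : R, 0 < p0 /\ forall x y, adj nb x y -> p0 <= mu x y / muv x.

Definition VD (rho : V -> V -> R) : Prop :=
  exists C : R, 0 < C /\ forall x (s : R), 0 < s ->
    (vol rho x (2 * s) <= C%:E * vol rho x s)%E.

Definition p1 (x y : V) : R := if adj nb x y then mu x y / muv x else 0.
Fixpoint pn (n : nat) (x y : V) : R :=
  match n with
  | 0%N => if x == y then 1 else 0
  | m.+1 => \sum_(z <- nb x) p1 x z * pn m z y
  end.
Definition hk (n : nat) (x y : V) : R := pn n x y / muv y.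

Definition energy (f : V -> R) : \bar R :=
  ((2^-1)%:E * \esum_(p in [set p : V * V | adj nb p.1 p.2])
      ((f p.1 - f p.2) ^+ 2 * mu p.1 p.2)%:E)%E.

(* effective resistance R(A,B) = (inf{E(f) : f|_A = 1, f|_B = 0})^{-1},
   with 1/+oo = 0 and 1/0 = +oo *)
Definition effres (A B : set V) : \bar R :=
  inve (ereal_inf [set energy f | f in
      [set f : V -> R | (forall x, A x -> f x = 1) /\ (forall x, B x -> f x = 0)]]).

(* the resistance metric R(x,y) = R({x},{y}) (finite on a connected graph) *)
Definition Rmet (x y : V) : R := fine (effres [set x] [set y]).

End Defs.

Definition homeo_halfline (R : realType) (theta : R -> R) : Prop :=
  exists thinv : R -> R,
    (forall t, 0 <= t -> 0 <= theta t) /\ (forall t, 0 <= t -> 0 <= thinv t) /\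
    (forall t, 0 <= t -> thinv (theta t) = t) /\
    (forall t, 0 <= t -> theta (thinv t) = t) /\
    {within [set t : R | 0 <= t], continuous theta} /\ {within [set t : R | 0 <= t], continuous thinv}.

Definition quasisymmetric (R : realType) (V : Type) (d rho : V -> V -> R) : Prop :=
  exists theta : R -> R, homeo_halfline theta /\
    forall x y z, x <> z -> rho x y / rho x z <= theta (d x y / d x z).

Definition fits (R : realType) (V : countType) (nb : V -> seq V) (d : V -> V -> R) : Prop :=
  (exists C : R, 0 < C /\ forall x y z, adj nb x y -> x <> z -> d x y <= C * d x z) /\
  (forall eps : R, 0 < eps -> exists (s : R) (n : nat) (xs : nat -> V),
     0 < s /\ (1 <= n)%N /\
     (forall i, (i < n)%N -> ball_m d (xs 0%N) s (xs i)) /\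
     ~ ball_m d (xs 0%N) s (xs n) /\
     (forall i, (1 <= i <= n)%N -> adj nb (xs i.-1) (xs i) /\ d (xs i) (xs i.-1) <= eps * s)).

(* Main.v *)
Require Import Defs.
From HB Require Import structures.
From mathcomp Require Import all_boot all_order all_algebra.
From mathcomp Require Import all_classical all_reals all_analysis.
From mathcomp Require Import zify ring lra.
Import Order.TTheory GRing.Theory Num.Theory.
Local Open Scope classical_set_scope.
Local Open Scope ring_scope.
Set Implicit Arguments. Unset Strict Implicit. Unset Printing Implicit Defensive.

(** Write [rho] for the resistance metric, [v x r] for the volume of its balls, and
    [phi x y = rho x y * (v x (rho x y) + v y (rho x y))], the time scale on which the walk
    started at [x] sees [y].  Doubling makes [phi] a quasi-metric, so for [beta] large
    [phi ^ (1 / beta)] is comparable to a metric [d] by the chain construction, and the ball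
    of [d]-radius [s] around [x] is comparable to the ball of [rho]-radius [r] with
    [r * v x r ~ s ^ beta].  The resistance bounds for [d] thus reduce to the fact that the
    resistance from [x] to the complement of a [rho]-ball of radius [r] is comparable to [r];
    the lower bound comes from the minimum of the potentials attached to a bounded net of
    the surrounding annulus.

    For the heat kernel at [o], put [f_k = h_2k + h_(2k+1)]: adding two consecutive times
    removes the parity problem.  The energy of [f_k] is [c_2k - c_(2k+1)], where
    [c_k = f_k o] is nonnegative and convex in [k], hence at most [c_k / (k + 1)].  Since [f_k]
    has mass 2, it is at most [3 / v o r] somewhere in the ball of radius [r], and the
    estimate [|f x - f y|^2 <= E(f) rho x y] bounds [c_k] from above.  Conversely, if [g] is a
    cutoff function of a larger ball, then [<h_2k, g>] changes by at most
    [sqrt (E(f_k) E(g))] when [k] increases by one; by the upper bound and [alpha < beta]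
    these changes sum to less than 1/2, so half of the mass stays in the ball, and
    Cauchy-Schwarz gives the lower bound.  The triangle inequality for [rho] is never
    needed exactly: a quasi-metric version follows at once from the estimate above. *)

(** * Finite sums for mass and energy *)

(** Turns bounds on extended-real sums into bounds on finite real sums, the form in which energies
    and volumes are handled below. *)
Lemma esum_leP (R : realType) (T : choiceType) (A : set T) (f : T -> R) (c : R) :
  (forall x, A x -> 0 <= f x) ->
  (\esum_(x in A) (f x)%:E <= c%:E)%E <->
  (forall U : seq T, uniq U -> (forall x, x \in U -> A x) ->
     \sum_(x <- U) f x <= c).
Proof.
move=> f0; split=> [le_c U uU UA|le_c].
  rewrite -lee_fin; apply: le_trans le_c; apply: esum_ge.
  exists [set` U]; first by split => //; exact: finite_seq.
  by rewrite -fsbig_seq// sumEFin.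
apply: ge_ereal_sup => _ [X [finX XA] <-].
rewrite fsbig_finite//= sumEFin lee_fin; apply: le_c => [|x].
  exact: finmap.fset_uniq.
by rewrite in_fset_set// inE => /XA.
Qed.

Lemma sum_sub_seq (R : realType) (T : eqType) (U W : seq T) (f : T -> R) :
  uniq U -> uniq W -> {subset U <= W} -> (forall x, 0 <= f x) ->
  \sum_(x <- U) f x <= \sum_(x <- W) f x.
Proof.
move=> uU uW UW f0.
have -> : \sum_(x <- U) f x = \sum_(x <- W | x \in U) f x.
  rewrite -[RHS]big_filter; apply: perm_big; apply: uniq_perm => //.
    exact: filter_uniq.
  by move=> x; rewrite mem_filter; case: (boolP (x \in U)) => // /UW ->.
rewrite [leRHS](bigID (fun x => x \in U))/= lerDl.
exact: sumr_ge0.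
Qed.

Lemma sum_supp (R : realType) (T : eqType) (U W : seq T) (f : T -> R) :
  uniq U -> uniq W -> (forall x, f x != 0 -> (x \in U) = (x \in W)) ->
  \sum_(x <- U) f x = \sum_(x <- W) f x.
Proof.
move=> uU uW UW.
rewrite (bigID (fun x => f x != 0))/= [RHS](bigID (fun x => f x != 0))/=.
rewrite [X in _ + X = _]big1 ?[X in _ = _ + X]big1 ?addr0; first last.
- by move=> i; rewrite negbK => /eqP.
- by move=> i; rewrite negbK => /eqP.
rewrite -[LHS]big_filter -[RHS]big_filter; apply: perm_big; apply: uniq_perm.
- exact: filter_uniq.
- exact: filter_uniq.
by move=> x; rewrite !mem_filter; case: eqP => //= /eqP /UW ->.
Qed.

Section Graph.
Context {R : realType} {V : countType} {nb : V -> seq V} {mu : V -> V -> R}.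
Context (Gs : simple_graph nb) (Gmu : conductance nb mu).

Let nb_uniq x : uniq (nb x) := Gs.1 x.
Let nbC x y : (y \in nb x) = (x \in nb y) := Gs.2.2 x y.

(** The extension of [mu] by zero off the edges: sums over neighbours become sums over arbitrary
    finite windows, and symmetry holds for all pairs. *)
Definition cond (x y : V) : R := if y \in nb x then mu x y else 0.

Lemma condC x y : cond x y = cond y x.
Proof.
rewrite /cond [x \in _]nbC; case: ifP => // xy.
by have [_ ->] := Gmu xy.
Qed.

Lemma cond_ge0 x y : 0 <= cond x y.
Proof. by rewrite /cond; case: ifP => // xy; have [/ltW] := Gmu xy. Qed.

Lemma muv_ge0 x : 0 <= muv nb mu x.
Proof.
rewrite /muv big_seq; apply: sumr_ge0 => y xy.
by have [/ltW] := @Gmu x y xy.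
Qed.

Lemma sum_nb x (U : seq V) (F : V -> R) :
  uniq U -> (forall y, y \in nb x -> F y != 0 -> y \in U) ->
  \sum_(y <- nb x) mu x y * F y = \sum_(y <- U) cond x y * F y.
Proof.
move=> uU xU.
transitivity (\sum_(y <- nb x) cond x y * F y).
  by apply: eq_big_seq => y xy; rewrite /cond xy.
apply: sum_supp => // y; rewrite mulf_eq0 negb_or /cond => /andP[].
by case: ifP; rewrite ?eqxx// => xy _ /xU -> .
Qed.

Lemma muvE x (U : seq V) : uniq U -> {subset nb x <= U} ->
  muv nb mu x = \sum_(y <- U) cond x y.
Proof.
move=> uU xU.
rewrite /muv; under eq_bigr do rewrite -[mu _ _]mulr1.
rewrite (@sum_nb x U (fun=> 1))//; last by move=> y /xU.
by under eq_bigr do rewrite mulr1.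
Qed.

(** The Dirichlet form of a finite window, polarised because heat kernels will be paired with cutoff
    functions. *)
Definition energy_on (U : seq V) (f g : V -> R) : R :=
  2^-1 * \sum_(x <- U) \sum_(y <- U) cond x y * ((f x - f y) * (g x - g y)).

Definition energy_le (f : V -> R) (c : R) : Prop :=
  forall U, uniq U -> energy_on U f f <= c.

Lemma energy_on_ge0 U f : 0 <= energy_on U f f.
Proof.
rewrite mulr_ge0// ?invr_ge0//; apply: sumr_ge0 => x _; apply: sumr_ge0 => y _.
by rewrite mulr_ge0 ?cond_ge0// -expr2 sqr_ge0.
Qed.

Lemma energy_le_ge0 f c : energy_le f c -> 0 <= c.
Proof. by move=> /(_ [::] isT); apply: le_trans; exact: energy_on_ge0. Qed.

Lemma energyP f c : (energy nb mu f <= c%:E)%E <-> energy_le f c.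
Proof.
have -> : (energy nb mu f <= c%:E)%E <->
    (\esum_(p in [set p : V * V | adj nb p.1 p.2])
      ((f p.1 - f p.2) ^+ 2 * mu p.1 p.2)%:E <= (2 * c)%:E)%E.
  by rewrite /energy muleC lee_pdivrMr// muleC -EFinM.
rewrite esum_leP; last first.
  by move=> [x y]/= xy; rewrite mulr_ge0 ?sqr_ge0//; have [/ltW] := Gmu xy.
have E (W : seq V) : \sum_(x <- W) \sum_(y <- W) cond x y * ((f x - f y) * (f x - f y)) =
    \sum_(p <- [seq p <- [seq (x, y) | x <- W, y <- W] | adj nb p.1 p.2])
      (f p.1 - f p.2) ^+ 2 * mu p.1 p.2.
  rewrite [RHS]big_filter [RHS]big_mkcond [RHS]big_allpairs/=.
  apply: eq_bigr => x _; apply: eq_bigr => y _.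
  by rewrite /cond /adj; case: ifP; rewrite ?mul0r// -expr2 mulrC.
split=> [H U uU|H U uU UA].
  rewrite /energy_on E ler_pdivrMl//; apply: H.
    by rewrite filter_uniq// allpairs_uniq// => -[? ?] [? ?].
  by move=> p; rewrite mem_filter => /andP[].
(* All endpoints of the pairs in [U]: the edges inside this window include every pair of [U]. *)
pose W := undup (map fst U ++ map snd U).
apply: le_trans (_ : 2 * energy_on W f f <= _); last first.
  by rewrite ler_pM2l//; apply: H; exact: undup_uniq.
rewrite /energy_on mulVKf// E.
have -> : \sum_(i <- U) (f i.1 - f i.2) ^+ 2 * mu i.1 i.2 =
  \sum_(i <- U) (f i.1 - f i.2) ^+ 2 * cond i.1 i.2.
  by apply: eq_big_seq => -[x y] /UA; rewrite /= /adj /cond => ->.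
have -> : \sum_(i <- [seq p <- [seq (x, y) | x <- W, y <- W] | adj nb p.1 p.2])
    (f i.1 - f i.2) ^+ 2 * mu i.1 i.2 = \sum_(i <- [seq p <- [seq (x, y) | x <- W, y <- W] | adj nb p.1 p.2])
    (f i.1 - f i.2) ^+ 2 * cond i.1 i.2.
  rewrite !big_filter; apply: eq_bigr => -[x y]/=.
  by rewrite /adj /cond => ->.
apply: sum_sub_seq => //.
- by rewrite filter_uniq// allpairs_uniq ?undup_uniq// => -[? ?] [? ?].
- move=> [x y] xyU; rewrite mem_filter (UA _ xyU)/=.
  apply/allpairsP; exists (x, y); split => //=; rewrite mem_undup mem_cat.
    by rewrite (map_f fst xyU).
  by rewrite (map_f snd xyU) orbT.
- by move=> p; rewrite mulr_ge0 ?sqr_ge0 ?cond_ge0.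
Qed.

Lemma musetP (A : set V) c :
  (muset nb mu A <= c%:E)%E <->
  (forall U, uniq U -> (forall x, x \in U -> A x) -> \sum_(x <- U) muv nb mu x <= c).
Proof. by apply: esum_leP => x _; exact: muv_ge0. Qed.

Lemma energy_on_sub U W f : uniq U -> uniq W -> {subset U <= W} ->
  energy_on U f f <= energy_on W f f.
Proof.
move=> uU uW UW; rewrite /energy_on ler_pM2l//.
have t0 x y : 0 <= cond x y * ((f x - f y) * (f x - f y)).
  by rewrite mulr_ge0 ?cond_ge0// -expr2 sqr_ge0.
apply: le_trans (_ : \sum_(x <- U) \sum_(y <- W) cond x y * ((f x - f y) * (f x - f y)) <= _).
  by apply: ler_sum => x _; apply: sum_sub_seq.
by apply: sum_sub_seq => // x; exact: sumr_ge0.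
Qed.

(* Every energy comparison (truncation, minimum, affine change) reduces to this
   edgewise domination. *)
Lemma energy_le_dom f g h a b cg ch : 0 <= a -> 0 <= b ->
  energy_le g cg -> energy_le h ch ->
  (forall x y, y \in nb x ->
     (f x - f y) ^+ 2 <= a * (g x - g y) ^+ 2 + b * (h x - h y) ^+ 2) ->
  energy_le f (a * cg + b * ch).
Proof.
move=> a0 b0 Eg Eh fgh U uU.
apply: le_trans (_ : a * energy_on U g g + b * energy_on U h h <= _); last first.
  by rewrite lerD// ler_wpM2l// ?Eg ?Eh.
rewrite /energy_on !(mulrCA _ 2^-1) -mulrDr ler_pM2l// !mulr_sumr -big_split/=.
apply: ler_sum => x _; rewrite !mulr_sumr -big_split/=; apply: ler_sum => y _.
rewrite !(mulrCA _ (cond _ _)) -mulrDr /cond; case: ifP => xy; last by rewrite !mul0r.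
have [m0 _] := Gmu xy.
by rewrite ler_pM2l// -!expr2; exact: fgh.
Qed.

Lemma energy_le1_dom f g a c : 0 <= a -> energy_le g c ->
  (forall x y, y \in nb x -> (f x - f y) ^+ 2 <= a * (g x - g y) ^+ 2) ->
  energy_le f (a * c).
Proof.
move=> a0 Eg fg; rewrite -[a * c]addr0 -[0](mul0r c).
by apply: (energy_le_dom _ _ Eg Eg) => // x y /fg; rewrite mul0r addr0.
Qed.

Lemma energy_le_weak f c c' : c <= c' -> energy_le f c -> energy_le f c'.
Proof. by move=> cc Ef U uU; apply: le_trans cc; exact: Ef. Qed.

(** Only edges at [x] contribute, each its conductance. *)
Lemma energy_le_indic x : energy_le (fun y => (y == x)%:R) (muv nb mu x).
Proof.
move=> U0 uU0.
pose U := undup (x :: nb x ++ U0).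
apply: le_trans (_ : energy_on U (fun y => (y == x)%:R) (fun y => (y == x)%:R) <= _).
  apply: energy_on_sub => //; first exact: undup_uniq.
  by move=> y yU; rewrite mem_undup inE mem_cat yU !orbT.
have uU : uniq U by exact: undup_uniq.
have xU : x \in U by rewrite mem_undup inE eqxx.
have nxU : {subset nb x <= U}.
  by move=> y yU; rewrite mem_undup inE mem_cat yU !orbT.
rewrite /energy_on ler_pdivrMl//.
have cxx : cond x x = 0 by rewrite /cond (negbTE (Gs.2.1 x)).
(* For [u], [v] in {0, 1} one has [(u - v) ^ 2 <= u + v], which bounds the double sum by two copies
   of [muv x]. *)
pose F y z := cond y z * ((y == x)%:R + (z == x)%:R).
apply: le_trans (_ : \sum_(y <- U) \sum_(z <- U) F y z <= _).
  apply: ler_sum => y _; apply: ler_sum => z _; rewrite /F ler_wpM2l ?cond_ge0//.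
  by case: (y == x); case: (z == x); rewrite /= ?subrr ?subr0 ?sub0r ?mulrNN; lra.
have dl : \sum_(y <- U) \sum_(z <- U) cond y z * (y == x)%:R = muv nb mu x.
  rewrite (bigD1_seq x)//= [X in _ + X]big1 ?addr0; last first.
    by move=> y /negbTE ->; apply: big1 => z _; rewrite mulr0.
  rewrite (muvE uU nxU); apply: eq_bigr => z _.
  by rewrite eqxx mulr1.
have dr : \sum_(y <- U) \sum_(z <- U) cond y z * (z == x)%:R = muv nb mu x.
  rewrite exchange_big/= -dl; apply: eq_bigr => y _; apply: eq_bigr => z _.
  by rewrite condC.
rewrite /F; under eq_bigr do under eq_bigr do rewrite mulrDr.
under eq_bigr do rewrite big_split/=.
rewrite big_split/= dl dr; lra.
Qed.

Lemma energy_edge f c x y : y \in nb x -> energy_le f c -> mu x y * (f x - f y) ^+ 2 <= c.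
Proof.
move=> xy Ef.
have nxy : x != y.
  by apply/eqP => e; move: (Gs.2.1 x); rewrite {1}e xy.
have /= := Ef [:: x; y]; rewrite /energy_on !big_cons !big_nil/= inE nxy => /(_ isT).
have -> : mu x y = cond x y by rewrite /cond xy.
rewrite (condC y x) !subrr !mulr0 !addr0 !add0r.
by move=> H; apply: le_trans H; rewrite -(opprB (f x) (f y)) mulrNN -expr2; lra.
Qed.

End Graph.

(** * Effective resistance *)

Section Resistance.
Context {R : realType} {V : countType} {nb : V -> seq V} {mu : V -> V -> R}.
Context (Gs : simple_graph nb) (Gc : connected_graph nb) (Gmu : conductance nb mu).

Local Notation energy_le := (@energy_le R V nb mu).
Local Notation Rmet := (Rmet nb mu).
Local Notation muv := (muv nb mu).

Lemma energy_ge0 f : (0 <= energy nb mu f)%E.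
Proof.
rewrite mule_ge0 ?lee_fin ?invr_ge0//; apply: esum_ge0 => -[x y]/= xy.
by rewrite lee_fin mulr_ge0 ?sqr_ge0//; have [/ltW] := Gmu xy.
Qed.

Lemma inve_anti (a b : \bar R) : (0 <= a -> a <= b -> b^-1 <= a^-1)%E.
Proof.
case: a b => [a| |] [b| |]//=; rewrite ?lee_fin ?leey ?invey//; last first.
  by move=> a0 _; rewrite inve_ge0 lee_fin.
rewrite !inver => a0 ab; case: eqP => [b0|/eqP b0]; case: eqP => [a00|/eqP a00] //.
- by case/negP: a00; rewrite eq_le a0 andbT -b0.
- by rewrite leey.
- have a1 : 0 < a by rewrite lt_neqAle eq_sym a00.
  by rewrite lee_fin lef_pV2 ?posrE// (lt_le_trans a1).
Qed.

Lemma effres_ge (A B : set V) g c : 0 < c ->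
  (forall x, A x -> g x = 1) -> (forall x, B x -> g x = 0) ->
  energy_le g c -> ((c^-1)%:E <= effres nb mu A B)%E.
Proof.
move=> c0 gA gB /(energyP Gmu) Eg.
have -> : ((c^-1)%:E = (c%:E)^-1 :> \bar R)%E by rewrite inver gt_eqF.
apply: inve_anti.
  by apply: le_ereal_inf_tmp => _ [f _ <-]; exact: energy_ge0.
by apply: le_trans Eg; apply: ereal_inf_lbound; exists g.
Qed.

(** Enlarging the zero set leaves fewer competitors, so the infimum rises and its inverse falls. *)
Lemma effres_anti (A B B' : set V) : B `<=` B' ->
  (effres nb mu A B' <= effres nb mu A B)%E.
Proof.
move=> BB; apply: inve_anti.
  by apply: le_ereal_inf_tmp => _ [f _ <-]; exact: energy_ge0.
apply: le_ereal_inf_tmp => _ [f [fA fB] <-]; apply: ereal_inf_lbound.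
by exists f => //; split => // x /BB /fB.
Qed.

(** No function is both 1 and 0 at [x], so the infimum runs over the empty set and equals [+oo],
    whose inverse is 0. *)
Lemma Rmetxx x : Rmet x x = 0.
Proof.
rewrite /Defs.Rmet /effres.
rewrite (_ : [set energy nb mu f | f in _] = set0) ?ereal_inf0 ?invey//.
apply/seteqP; split=> [t [f [fx f0] _]|]//.
by have := oner_neq0 R; rewrite -(fx x erefl) (f0 x erefl) eqxx.
Qed.

(** Each edge difference is controlled by the energy, and the path chains them; [K] depends on the
    path alone. This keeps the infimum defining the resistance away from 0. *)
Lemma path_poincare x p : path (adj nb) x p ->
  exists2 K : R, 0 < K & forall f c, energy_le f c -> (f x - f (last x p)) ^+ 2 <= K * c.
Proof.
elim: p x => [x _|y p IH x /=/andP[xy /IH[K K0 HK]]].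
  exists 1 => // f c /= Ef; rewrite subrr expr0n/= mul1r.
  exact: energy_le_ge0 Ef.
have [m0 _] := Gmu xy.
exists (2 / mu x y + 2 * K) => [|f c Ef]; first by rewrite addr_gt0 ?mulr_gt0 ?invr_gt0.
have h1 : (f x - f y) ^+ 2 <= (mu x y)^-1 * c.
  by rewrite ler_pdivlMl//; exact: energy_edge Ef.
have h2 := HK _ _ Ef.
set z := f (last y p) in h2 *.
have : (f x - z) ^+ 2 <= 2 * (f x - f y) ^+ 2 + 2 * (f y - z) ^+ 2.
  have := sqr_ge0 ((f x - f y) - (f y - z)); nra.
have -> : (2 / mu x y + 2 * K) * c = 2 * ((mu x y)^-1 * c) + 2 * (K * c) by ring.
by lra.
Qed.

(** [path_poincare] makes the infimum positive and the indicator of [x] makes it finite, so [inve]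
    and [fine] meet no degenerate case. *)
Lemma Rmet_spec x y : x != y -> exists2 r : R, 0 < r &
  ereal_inf [set energy nb mu f | f in
    [set f : V -> R | (forall z, [set x] z -> f z = 1) /\ (forall z, [set y] z -> f z = 0)]]
   = r%:E /\ Rmet x y = r^-1.
Proof.
move=> nxy; have [p [xp py]] := Gc x y.
have [K K0 HK] := path_poincare xp; rewrite py in HK.
rewrite /Defs.Rmet /effres; set m := ereal_inf _.
have mK : (K^-1%:E <= m)%E.
  apply: le_ereal_inf_tmp => _ [f [fx fy] <-].
  have := energy_ge0 f; case E: energy => [c| |]//; rewrite ?leey// => _.
  have /(energyP Gmu)/HK : (energy nb mu f <= c%:E)%E by rewrite E.
  by rewrite fx// fy// subr0 expr1n lee_fin -div1r ler_pdivrMr// mulrC.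
have mx : (m <= (muv x)%:E)%E.
  apply: le_trans (_ : energy nb mu (fun z => (z == x)%:R) <= _)%E.
    apply: ereal_inf_lbound; exists (fun z => (z == x)%:R) => //; split => z /= ->.
      by rewrite eqxx.
    by rewrite eq_sym (negbTE nxy).
  by apply/(energyP Gmu); exact: energy_le_indic.
case: m mK mx => [r| |]//; rewrite !lee_fin => rK _.
have r0 : 0 < r by apply: lt_le_trans rK; rewrite invr_gt0.
by exists r => //; rewrite inver gt_eqF.
Qed.

Lemma Rmet_gt0 x y : x != y -> 0 < Rmet x y.
Proof. by move=> /Rmet_spec[r r0 [_ ->]]; rewrite invr_gt0. Qed.

Lemma effresE x y : x != y -> effres nb mu [set x] [set y] = (Rmet x y)%:E.
Proof.
by move=> /Rmet_spec[r r0 [infE ->]]; rewrite /effres infE inver gt_eqF.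
Qed.

Lemma Rmet_ge0 x y : 0 <= Rmet x y.
Proof. by have [->|/Rmet_gt0/ltW//] := eqVneq x y; rewrite Rmetxx. Qed.

Lemma energy_le_affine f c a b : energy_le f c -> energy_le (fun z => a * f z + b) (a ^+ 2 * c).
Proof.
move=> Ef; apply: (@energy_le1_dom _ _ _ _ Gmu) Ef _; first exact: sqr_ge0.
by move=> x y _; rewrite le_eqVlt; apply/orP; left; apply/eqP; ring.
Qed.

(** Normalised affinely to the values 1 at [x] and 0 at [y], the function [f] competes in the
    infimum. *)
Lemma Rmet_holder f c x y : energy_le f c -> (f x - f y) ^+ 2 <= c * Rmet x y.
Proof.
move=> Ef; have c0 := energy_le_ge0 Gmu Ef.
have [exy|nexy] := eqVneq (f x) (f y).
  by rewrite exy subrr expr0n/= mulr_ge0 ?Rmet_ge0.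
have nxy : x != y by apply: contraNneq nexy => ->.
have [r r0 [infE ->]] := Rmet_spec nxy.
have D0 : f x - f y != 0 by rewrite subr_eq0.
have D2 : 0 < (f x - f y) ^+ 2 by rewrite lt_neqAle sqr_ge0 eq_sym expf_eq0/= D0.
have Eg := @energy_le_affine f c (f x - f y)^-1 (- (f x - f y)^-1 * f y) Ef.
rewrite ler_pdivlMr// mulrC -ler_pdivlMr//.
rewrite -lee_fin -infE; apply: le_trans (_ : energy nb mu _ <= _)%E; last first.
  by apply/(energyP Gmu); rewrite mulrC -exprVn; exact: Eg.
apply: ereal_inf_lbound; eexists; last reflexivity.
split => z /= ->; first by rewrite mulNr -mulrBr mulVf.
by rewrite mulNr -mulrBr subrr mulr0.
Qed.

(** The factor 2 replaces the existence of a minimiser: the infimum [r] is positive, so some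
    competitor has energy below [2 * r]. *)
Lemma Rmet_potential x y : x != y ->
  exists f : V -> R, [/\ f x = 1, f y = 0 & energy_le f (2 / Rmet x y)].
Proof.
move=> nxy; have [r r0 [infE ->]] := Rmet_spec nxy; rewrite invrK.
apply: contrapT => H.
suff : ((2 * r)%:E <= r%:E)%E by rewrite lee_fin => ?; lra.
rewrite -infE; apply: le_ereal_inf_tmp => _ [f [fx fy] <-].
rewrite leNgt; apply/negP => Ef; apply: H; exists f.
by split; [exact: fx|exact: fy|apply/(energyP Gmu)/ltW].
Qed.

(** The substitution of [1 - f] for [f] exchanges the two boundary values and keeps the energy. *)
Lemma Rmet_sym x y : Rmet x y = Rmet y x.
Proof.
have [->//|nxy] := eqVneq x y.
suff le x' y' : x' != y' -> Rmet x' y' <= Rmet y' x'.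
  by apply/eqP; rewrite eq_le !le// eq_sym.
move=> {x y nxy} {}nxy; have nyx : y' != x' by rewrite eq_sym.
have [r r0 [infE Er]] := Rmet_spec nyx; rewrite Er.
have [r' r0' [infE' ->]] := Rmet_spec nxy.
rewrite lef_pV2 ?posrE// -lee_fin -infE -infE'.
apply: le_ereal_inf_tmp => _ [f [fx fy] <-].
have := energy_ge0 f; case E: energy => [c| |]//; rewrite ?leey// => _.
have /(energyP Gmu) Ef : (energy nb mu f <= c%:E)%E by rewrite E.
apply: le_trans (_ : energy nb mu (fun z => (-1) * f z + 1)%R <= _)%E.
  by apply: ereal_inf_lbound; eexists; last reflexivity;
    split => z /= ->; rewrite ?(fx _ erefl) ?(fy _ erefl); ring.
apply/(energyP Gmu); have := @energy_le_affine f c (-1) 1 Ef.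
by rewrite sqrrN expr1n mul1r.
Qed.

(** A near-optimal potential between [x] and [z] satisfies [1/2 <= (1 - f y)^2 + (f y)^2], and each
    square is at most [2 M / Rmet x z], with [M] the maximum on the right; hence the constant 8. *)
Lemma Rmet_quasi x y z : Rmet x z <= 8 * Num.max (Rmet x y) (Rmet y z).
Proof.
have [->|nxz] := eqVneq x z.
  by rewrite Rmetxx mulr_ge0// le_max Rmet_ge0.
have [f [fx fz Ef]] := Rmet_potential nxz.
have h1 := Rmet_holder x y Ef; have h2 := Rmet_holder y z Ef.
set M := Num.max _ _.
have m1 : Rmet x y <= M by rewrite le_max lexx.
have m2 : Rmet y z <= M by rewrite le_max lexx orbT.
have r0 := Rmet_gt0 nxz.
have c0 : 0 <= 2 / Rmet x z by rewrite divr_ge0// ltW.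
have k1 := le_trans h1 (ler_wpM2l c0 m1); have k2 := le_trans h2 (ler_wpM2l c0 m2).
rewrite fx fz in k1 k2.
have : 2^-1 <= (1 - f y) ^+ 2 + (f y - 0) ^+ 2 by have := sqr_ge0 (f y - 2^-1); nra.
have : 2^-1 <= 4 * (M / Rmet x z) -> Rmet x z <= 8 * M.
  by rewrite mulrA ler_pdivlMr//; lra.
have e : 2 / Rmet x z * M = 2 * (M / Rmet x z) by ring.
by move=> H ?; apply: H; rewrite e in k1 k2; lra.
Qed.

Lemma muv_gt0 x : infinite_set [set: V] -> 0 < muv x.
Proof.
move=> infV.
have [y /eqP nyx] : exists y, y <> x.
  apply: contrapT => H; apply: infV; apply: (@sub_finite_set _ _ [set x]) => //.
  by move=> y _; apply: contrapT => yx; apply: H; exists y.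
have [p] := Gc x y; case: p => [[_ /= e]|z p [/=/andP[xz _] _]].
  by rewrite e eqxx in nyx.
have [m0 _] := Gmu xz; rewrite /Defs.muv (bigD1_seq z)//=; last exact: Gs.1.
rewrite ltr_pwDl// big_seq_cond sumr_ge0// => w /andP[xw _].
by have [/ltW] := @Gmu x w xw.
Qed.

(** The indicator of [x] is the test function. Thus balls around [x] of radius at most [1 / muv x]
    are single points. *)
Lemma Rmet_ge x y : x != y -> (muv x)^-1 <= Rmet x y.
Proof.
move=> nxy; have := Rmet_holder x y (energy_le_indic Gs Gmu x).
rewrite eqxx eq_sym (negbTE nxy) subr0 expr1n => H.
have m0 : 0 < muv x.
  rewrite lt_neqAle (muv_ge0 Gmu) andbT; apply/negP => /eqP E.
  by move: H; rewrite -E mul0r ler10.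
by rewrite -div1r ler_pdivrMr// mulrC.
Qed.

(** A near-optimal potential drops by 1 across the edge, which alone costs [mu x y]. *)
Lemma Rmet_edge x y : y \in nb x -> Rmet x y <= 2 / mu x y.
Proof.
move=> xy; have [m0 _] := Gmu xy.
have nxy : x != y.
  by apply/eqP => e; move: (Gs.2.1 x); rewrite {1}e xy.
have [f [fx fy Ef]] := Rmet_potential nxy.
have := energy_edge Gs Gmu xy Ef; rewrite fx fy subr0 expr1n mulr1.
have r0 := Rmet_gt0 nxy.
by rewrite !ler_pdivlMr// mulrC.
Qed.

End Resistance.

(** * Chain metrics *)

Section ChainMetric.
Context {R : realType} {T : countType} (q : T -> T -> R).
Hypothesis q_ge0 : forall x y, 0 <= q x y.
Hypothesis q_eq0 : forall x y, q x y = 0 <-> x = y.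
Hypothesis q_sym : forall x y, q x y = q y x.
(** Frink's condition on three consecutive links; with the factor 2, sums along chains of any length
    stay comparable to [q]. *)
Hypothesis q_quasi : forall x y z w,
  q x w <= 2 * Num.max (q x y) (Num.max (q y z) (q z w)).

Fixpoint chain_len x (p : seq T) : R :=
  if p is y :: p' then q x y + chain_len y p' else 0.

Lemma chain_len_ge0 x p : 0 <= chain_len x p.
Proof. by elim: p x => //= y p IH x; rewrite addr_ge0. Qed.

Lemma chain_len_cat x p1 p2 :
  chain_len x (p1 ++ p2) = chain_len x p1 + chain_len (last x p1) p2.
Proof. by elim: p1 x => [|y p1 IH] x /=; rewrite ?add0r// IH addrA. Qed.

Lemma last_rev_belast (x : T) p : last (last x p) (rev (belast x p)) = x.
Proof. by case: p => //= y p; rewrite rev_cons last_rcons. Qed.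

Lemma chain_len_rev x p : chain_len (last x p) (rev (belast x p)) = chain_len x p.
Proof.
elim: p x => //= y p IH x; rewrite rev_cons -cats1 chain_len_cat IH/=.
by rewrite last_rev_belast addr0 addrC q_sym.
Qed.

(** [p1] is the longest initial piece of length at most [h] that leaves at least one link; the link
    to [y] either passes [h] or ends the chain. *)
Lemma chain_split p x h : 0 <= h -> p <> [::] ->
  exists p1 y p2, [/\ p = p1 ++ y :: p2, chain_len x p1 <= h &
    p2 = [::] \/ h < chain_len x p1 + q (last x p1) y].
Proof.
elim: p x h => // y p IH x h h0 _.
have [hq|qh] := ltP h (q x y).
  by exists [::], y, p; split => //=; right; rewrite add0r.
case: p IH => [|z p] IH.
  by exists [::], y, [::]; split => //; left.
have [||p1 [w [p2 [-> l1 H]]]] := IH y (h - q x y) => //; first by rewrite subr_ge0.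
exists (y :: p1), w, p2; split => //=; first by rewrite addrC -lerBrDr.
by case: H => [->|H]; [left|right; rewrite -addrA addrC -ltrBlDr].
Qed.

(* Cut the chain at its half-length: both halves are bounded inductively and
   the middle edge is bounded by the total length. *)
Lemma quasi_le_chain x p : q x (last x p) <= 2 * chain_len x p.
Proof.
have [n] := ubnP (size p); elim: n p x => // n IH p x sp.
have [p0|np] := pselect (p = [::]).
  by rewrite p0 /= (q_eq0 x x).2// mulr0.
have S0 := chain_len_ge0 x p; set S := chain_len x p in S0 *.
have [|p1 [y [p2 [Ep l1 H]]]] := @chain_split p x (S / 2) _ np; first by rewrite divr_ge0.
have ES : S = chain_len x p1 + q (last x p1) y + chain_len y p2.
  by rewrite /S Ep chain_len_cat/= addrA.
have sz : (size p1 < n)%N /\ (size p2 < n)%N.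
  by move: sp; rewrite Ep size_cat/= ltnS => sp; split; lia.
have l2 : chain_len y p2 <= S / 2.
  by case: H => [->|H]; [rewrite /= divr_ge0|lra].
have I1 := IH _ x sz.1; have I2 := IH _ y sz.2.
rewrite Ep last_cat/=; apply: le_trans (@q_quasi _ (last x p1) y _) _.
rewrite ler_pM2l// !ge_max; apply/and3P; split; [lra| |lra].
by have := chain_len_ge0 x p1; have := chain_len_ge0 y p2; lra.
Qed.

Definition chain_dist x y := inf [set chain_len x p | p in [set p | last x p = y]].

Let chains x y := [set chain_len x p | p in [set p | last x p = y]].

Let chains_lb x y : has_lbound (chains x y).
Proof. by exists 0 => _ [p _ <-]; exact: chain_len_ge0. Qed.

Let chains_n0 x y : chains x y !=set0.
Proof. by exists (chain_len x [:: y]); exists [:: y]. Qed.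

Lemma chain_dist_le x p : chain_dist x (last x p) <= chain_len x p.
Proof. by apply: (ge_inf (chains_lb x _)); exists p. Qed.

Lemma chain_dist_le_quasi x y : chain_dist x y <= q x y.
Proof. by have := chain_dist_le x [:: y]; rewrite /= addr0. Qed.

Lemma quasi_le_chain_dist x y : q x y <= 2 * chain_dist x y.
Proof.
rewrite -ler_pdivrMl//; apply: (lb_le_inf (chains_n0 x y)) => _ [p /= <- <-].
by rewrite ler_pdivrMl//; exact: quasi_le_chain.
Qed.

Lemma chain_dist_metric : is_metric chain_dist.
Proof.
have D0 x y : 0 <= chain_dist x y.
  by have := le_trans (q_ge0 x y) (quasi_le_chain_dist x y); rewrite pmulr_rge0.
split=> //; split; [|split].
- move=> x y; split=> [E|<-].
    apply/q_eq0/eqP; rewrite eq_le q_ge0 andbT.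
    by apply: le_trans (quasi_le_chain_dist x y) _; rewrite E mulr0.
  by apply/eqP; rewrite eq_le D0 andbT -[leRHS](q_eq0 x x).2// chain_dist_le_quasi.
- suff le x y : chain_dist x y <= chain_dist y x.
    by move=> x y; apply/eqP; rewrite eq_le !le.
  apply: (lb_le_inf (chains_n0 y x)) => _ [p /= <- <-].
  by rewrite -chain_len_rev -[X in chain_dist _ X <= _](last_rev_belast y p) chain_dist_le.
- move=> x y z; rewrite -lerBlDl.
  apply: (lb_le_inf (chains_n0 y z)) => _ [p2 /= <- <-].
  rewrite lerBlDl -lerBlDr; apply: (lb_le_inf (chains_n0 x y)) => _ [p1 /= <- <-].
  by rewrite lerBlDr -chain_len_cat -last_cat chain_dist_le.
Qed.

End ChainMetric.

(** * Doubling quasi-metric spaces *)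

Section Doubling.
Context {R : realType} {T : Type} (rho : T -> T -> R) (v : T -> R -> R) (a : nat).
Hypothesis rho_ge0 : forall x y, 0 <= rho x y.
Hypothesis rho_sym : forall x y, rho x y = rho y x.
Hypothesis rho_quasi : forall x y z, rho x z <= 8 * Num.max (rho x y) (rho y z).
Hypothesis v_ge0 : forall x s, 0 <= v x s.
Hypothesis v_gt0 : forall x s, 0 < s -> 0 < v x s.
Hypothesis v_sub : forall x y s t,
  (forall z, rho y z < s -> rho x z < t) -> v y s <= v x t.
(** Doubling with exponent [a]; the factor 2 absorbs the rounding of [s / t] to a power of two. *)
Hypothesis v_pow : forall x s t, 0 < t -> t <= s ->
  v x s <= (2 * (s / t)) ^+ a * v x t.

Lemma v_mono x s t : s <= t -> v x s <= v x t.
Proof. by move=> st; apply: v_sub => z zs; exact: lt_le_trans st. Qed.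

Lemma v_scale x A t : 0 < t -> 1 <= A -> v x (A * t) <= (2 * A) ^+ a * v x t.
Proof.
move=> t0 A1; have := @v_pow x (A * t) t t0; rewrite mulfK ?gt_eqF//.
by apply; rewrite ler_peMl// ltW.
Qed.

(** Both centres enter for the sake of symmetry; by doubling, either term alone is comparable to the
    sum. *)
Definition phi x y := rho x y * (v x (rho x y) + v y (rho x y)).

Lemma phi_sym x y : phi x y = phi y x.
Proof. by rewrite /phi [in LHS]rho_sym addrC. Qed.

Lemma phi_ge0 x y : 0 <= phi x y.
Proof. by rewrite mulr_ge0// addr_ge0. Qed.

Lemma phi_ge x y : rho x y * v x (rho x y) <= phi x y.
Proof. by rewrite ler_wpM2l// lerDl. Qed.

Let L : R := 18 ^+ a + 1.

Let L1 : 1 <= L. Proof. by rewrite lerDr exprn_ge0. Qed.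
Let L0 : 0 < L. Proof. exact: lt_le_trans L1. Qed.

Lemma phi_le x y : phi x y <= L * (rho x y * v x (rho x y)).
Proof.
have [r0|r0] := eqVneq (rho x y) 0; first by rewrite /phi r0 !mul0r mulr0.
have {}r0 : 0 < rho x y by rewrite lt_neqAle eq_sym r0 rho_ge0.
rewrite /phi mulrCA ler_pM2l// mulrDl mul1r addrC lerD2r.
(* The quasi-triangle inequality with constant 8 puts the ball around [y] inside the ball around [x]
   of nine times the radius; this is the source of [18 = 2 * 9] in [L]. *)
have /le_trans : v y (rho x y) <= v x (9 * rho x y).
  apply: v_sub => z yz; apply: le_lt_trans (rho_quasi x y z) _.
  by rewrite max_l ?(ltW yz)//; lra.
apply; have -> : (18 : R) = 2 * 9 by lra.
by apply: v_scale => //; lra.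
Qed.

Let pv_mono x s t : 0 <= s -> s <= t -> s * v x s <= t * v x t.
Proof. by move=> s0 st; rewrite ler_pM// v_mono. Qed.

Lemma phi_scale x y z A : 1 <= A -> rho x z <= A * rho x y ->
  phi x z <= L * (A * (2 * A) ^+ a) * phi x y.
Proof.
move=> A1 zy; have A0 : 0 < A by exact: lt_le_trans A1.
apply: le_trans (phi_le _ _) _; rewrite -mulrA ler_pM2l//.
apply: le_trans (pv_mono _ (rho_ge0 x z) zy) _.
have [r0|r0] := eqVneq (rho x y) 0.
  by rewrite r0 mulr0 mul0r mulr_ge0 ?phi_ge0// mulr_ge0 ?exprn_ge0// ?mulr_ge0// ltW.
have {}r0 : 0 < rho x y by rewrite lt_neqAle eq_sym r0 rho_ge0.
rewrite -!mulrA ler_pM2l//.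
apply: le_trans (ler_wpM2l (ltW r0) (v_scale x r0 A1)) _.
rewrite mulrCA ler_wpM2l ?phi_ge// exprn_ge0// mulr_ge0// ltW//.
Qed.

Definition quasi_cst : R := L * (8 * (2 * 8) ^+ a).

(** The longer leg is compared with the pair [x], [z] from the endpoint they share: there [rho x z]
    is at most 8 times that leg, and [phi_scale] applies with [A = 8]. *)
Lemma phi_quasi x y z : phi x z <= quasi_cst * Num.max (phi x y) (phi y z).
Proof.
have K0 : 0 <= quasi_cst by rewrite mulr_ge0 ?(ltW L0)// mulr_ge0// exprn_ge0.
have [yz|/ltW yz] := leP (rho y z) (rho x y).
  apply: le_trans (_ : quasi_cst * phi x y <= _).
    apply: phi_scale; first by lra.
    by apply: le_trans (rho_quasi x y z) _; rewrite max_l.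
  by rewrite ler_wpM2l// le_max lexx.
apply: le_trans (_ : quasi_cst * phi z y <= _).
  rewrite phi_sym; apply: phi_scale; first by lra.
  by apply: le_trans (rho_quasi z y x) _; rewrite max_l// ![rho _ y]rho_sym// rho_sym.
by rewrite ler_wpM2l// le_max (phi_sym z) lexx orbT.
Qed.

(** [phi] grows at least linearly in [rho], by monotonicity of the volume. *)
Lemma phi_far x y z A : 0 <= A -> rho x y <= rho x z -> A * rho x y <= rho x z ->
  A * phi x y <= L * phi x z.
Proof.
move=> A0 yz Ayz.
apply: le_trans (ler_wpM2l A0 (phi_le _ _)) _.
rewrite mulrCA ler_pM2l//; apply: le_trans (phi_ge x z).
by rewrite mulrA ler_pM// ?mulr_ge0// v_mono.
Qed.

(** [phi] grows at most like the power [a + 1] of [rho]: one power from the factor [rho] and [a]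
    from doubling. *)
Lemma phi_near x y z (X : R) : 0 < X -> X <= 1 -> rho x y = X * rho x z ->
  X ^+ a.+1 * phi x z <= 2 ^+ a * L * phi x y.
Proof.
move=> X0 X1 yz.
have [r0|r0] := eqVneq (rho x z) 0.
  by rewrite {1}/phi r0 mul0r mulr0 mulr_ge0 ?phi_ge0// mulr_ge0 ?exprn_ge0// ltW.
have {}r0 : 0 < rho x z by rewrite lt_neqAle eq_sym r0 rho_ge0.
have y0 : 0 < rho x y by rewrite yz mulr_gt0.
have yz' : rho x y <= rho x z by rewrite yz ger_pMl.
have zyX : rho x z / rho x y = X^-1 by rewrite yz; field; rewrite !gt_eqF.
have := v_pow x y0 yz'; rewrite zyX exprMn exprVn => Hv.
have Xa : 0 < X ^+ a.+1 by rewrite exprn_gt0.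
apply: le_trans (ler_wpM2l (ltW Xa) (phi_le _ _)) _.
rewrite mulrCA [2 ^+ a * L]mulrC -mulrA ler_pM2l//.
apply: le_trans (_ : 2 ^+ a * (rho x y * v x (rho x y)) <= _); last first.
  by rewrite ler_wpM2l ?phi_ge// exprn_ge0.
apply: le_trans (_ : X ^+ a.+1 * (rho x z * (2 ^+ a / X ^+ a * v x (rho x y))) <= _).
  by rewrite ler_pM2l// ler_pM2l.
rewrite yz exprS le_eqVlt; apply/orP; left; apply/eqP.
by field; rewrite expf_eq0 gt_eqF// andbF.
Qed.

Context (d : T -> T -> R) (b : nat) (vd : T -> R -> R) (C1 : R).
Hypothesis b_gt0 : (0 < b)%N.
Hypothesis d_ge0 : forall x y, 0 <= d x y.
Hypothesis d_le : forall x y, d x y ^+ b <= phi x y.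
Hypothesis d_ge : forall x y, phi x y <= 2 ^+ b * d x y ^+ b.
Hypothesis vd_le : forall x s t,
  (forall z, d x z < s -> rho x z < t) -> vd x s <= v x t.
Hypothesis vd_ge : forall x s t,
  (forall z, rho x z < t -> d x z < s) -> v x t <= vd x s.
Hypothesis C1_ge1 : 1 <= C1.
(** Uniform perfectness, asked only from scale 1/2 on: in the application distinct points are at
    distance at least 1/2. *)
Hypothesis perfect : forall x s, 2^-1 <= s -> exists y, s <= d x y <= C1 * s.

(* [rho x y] is the resistance scale matching the [d]-radius [s] around [x]. *)
Definition scale A x s y :=
  [/\ 0 < rho x y, s <= d x y,
      forall z, d x z < s -> rho x z < A * rho x y,
      forall z, A * rho x z < rho x y -> d x z < s &
  [/\ v x (rho x y) <= A * vd x s, vd x s <= A * v x (rho x y),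
      s ^+ b <= A * (rho x y * v x (rho x y)) &
      rho x y * v x (rho x y) <= A * s ^+ b]].

Lemma scaleP : exists2 A, 1 <= A & forall x s, 2^-1 <= s -> exists y, scale A x s y.
Proof.
(* [phi] at the witness [y] is at most [(2 * C1) ^+ b * s ^+ b]. Taking [B] twice [L] times that
   constant makes both comparisons of balls, [h1] and [h2], strict. *)
pose B : R := 2 * L * (2 * C1) ^+ b.
have C10 : 0 < C1 by exact: lt_le_trans C1_ge1.
have C11 := C1_ge1.
have Cb1 : 1 <= (2 * C1) ^+ b by rewrite exprn_ege1//; lra.
have EB : B / 2 = L * (2 * C1) ^+ b by rewrite /B; field.
have LB : L <= B / 2 by rewrite EB ler_peMr// ltW.
have CB : (2 * C1) ^+ b <= B / 2 by rewrite EB ler_peMl// exprn_ge0// mulr_ge0// ltW.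
have B1 : 1 <= B by have := L1; lra.
have B0 : 0 < B by lra.
have Ba1 : 1 <= (2 * B) ^+ a by rewrite exprn_ege1//; lra.
(* The second factor is the doubling cost of enlarging a radius [B] times. *)
pose A := B * (2 * B) ^+ a.
have BA : B <= A by rewrite ler_peMr// ltW.
have aA : (2 * B) ^+ a <= A by rewrite ler_peMl//; lra.
exists A => [|x s s12]; first by lra.
have s0 : 0 < s by lra.
have [y /andP[sy ys]] := perfect x s12; exists y.
have sb : s ^+ b <= phi x y.
  by apply: le_trans (d_le _ _); rewrite lerXn2r// nnegrE// ltW.
have sb0 : 0 < s ^+ b by rewrite exprn_gt0.
have phiy : phi x y <= (2 * C1) ^+ b * s ^+ b.
  apply: le_trans (d_ge _ _) _; rewrite -exprMn -exprMn lerXn2r ?nnegrE ?mulr_ge0//.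
  - by rewrite ltW.
  - by rewrite ltW.
  - by rewrite -mulrA ler_pM2l.
have r0 : 0 < rho x y.
  rewrite lt_neqAle rho_ge0 andbT; apply/negP => /eqP E.
  by move: sb; rewrite /phi -E mul0r leNgt sb0.
have h1 z : d x z < s -> rho x z < B * rho x y.
  move=> zs; rewrite ltNge; apply/negP => far.
  have yz : rho x y <= rho x z by apply: le_trans far; rewrite ler_peMl// ltW.
  have := phi_far (ltW B0) yz far.
  have : phi x z <= 2 ^+ b * s ^+ b.
    apply: le_trans (d_ge _ _) _; rewrite ler_wpM2l ?exprn_ge0//.
    by rewrite lerXn2r ?nnegrE// ltW.
  have : 2 ^+ b <= (2 * C1) ^+ b.
    by rewrite lerXn2r ?nnegrE//; lra.
  move=> p1 p2 p3.
  have q1 : phi x z <= (2 * C1) ^+ b * s ^+ b.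
    by apply: le_trans p2 _; rewrite ler_pM2r.
  have q2 : B * s ^+ b <= L * ((2 * C1) ^+ b * s ^+ b).
    apply: le_trans (_ : B * phi x y <= _); first by rewrite ler_pM2l.
    by apply: le_trans p3 _; rewrite ler_pM2l.
  move: q2; rewrite mulrA ler_pM2r// /B -mulrA.
  by rewrite -[leRHS]mul1r ler_pM2r ?mulr_gt0//; lra.
have h2 z : B * rho x z < rho x y -> d x z < s.
  move=> near.
  have yz : rho x z <= rho x y.
    by apply: le_trans (ltW near); rewrite ler_peMl.
  have p1 := phi_far (ltW B0) yz (ltW near).
  have p2 : B * phi x z <= L * ((2 * C1) ^+ b * s ^+ b).
    by apply: le_trans p1 _; rewrite ler_pM2l.
  have p3 : phi x z <= 2^-1 * s ^+ b.
    rewrite -(ler_pM2l B0); apply: le_trans p2 _.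
    by rewrite le_eqVlt; apply/orP; left; apply/eqP; rewrite /B; field.
  rewrite ltNge; apply/negP => sz.
  have : s ^+ b <= d x z ^+ b by rewrite lerXn2r ?nnegrE// ltW.
  by move=> /le_trans /(_ (le_trans (d_le _ _) p3)); lra.
have v0 := v_gt0 x r0.
have g1 : vd x s <= A * v x (rho x y).
  apply: le_trans (vd_le h1) _; apply: le_trans (v_scale x r0 B1) _.
  by rewrite ler_pM2r.
have g2 : v x (rho x y) <= A * vd x s.
  have e : rho x y = B * (B^-1 * rho x y) by rewrite mulVKf// gt_eqF.
  have rB0 : 0 < B^-1 * rho x y by rewrite mulr_gt0 ?invr_gt0.
  have H : v x (B^-1 * rho x y) <= vd x s.
    by apply: vd_ge => z; rewrite ltr_pdivlMl// => /h2.
  rewrite {1}e; apply: le_trans (v_scale x rB0 B1) _.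
  by rewrite ler_pM// ?exprn_ge0// mulr_ge0// ltW.
split => //.
- by move=> z /h1 zB; apply: lt_le_trans zB _; rewrite ler_pM2r.
- move=> z zA; apply: h2; apply: le_lt_trans zA.
  by rewrite ler_wpM2r.
split => //.
- apply: le_trans sb _; apply: le_trans (phi_le x y) _; rewrite ler_wpM2r ?mulr_ge0//; lra.
- apply: le_trans (phi_ge x y) _; apply: le_trans phiy _; rewrite ler_wpM2r ?(ltW sb0)//; lra.
Qed.

Lemma scale_vd_gt0 A x s y : 1 <= A -> scale A x s y -> 0 < vd x s.
Proof.
move=> A1 [r0 _ _ _ [vvd _ _ _]]; have := lt_le_trans (v_gt0 x r0) vvd.
by rewrite pmulr_rgt0//; lra.
Qed.

(** Doubling bounds the volume ratio by the power [a] of the radius ratio [r / r'], while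
    [r * v x r ~ s ^+ b] expresses [r / r'] through [s / t] and the volumes. Eliminating it gives
    the exponent [a * b / (a + 1)], strictly below [b]; powers [a.+1] avoid real exponents. *)
Lemma volume_growth : exists2 C, 0 < C & forall x s t, 2^-1 <= t -> t <= s ->
  vd x s ^+ a.+1 <= C * (s / t) ^+ (a * b) * vd x t ^+ a.+1.
Proof.
have [A A1 HA] := scaleP; have A0 : 0 < A by lra.
pose D : R := (2 * A ^+ 2) ^+ a.
have D1 : 1 <= D by rewrite exprn_ege1// mulr_ege1 ?ler1n// exprn_ege1.
have D0 : 0 < D by exact: lt_le_trans D1.
exists (A ^+ a.+1 * A ^+ a.+1 * D) => [|x s t t12 ts]; first by rewrite !mulr_gt0// exprn_gt0.
have t0 : 0 < t by lra.
have s0 : 0 < s by lra.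
have [y sc] := HA x s (le_trans t12 ts); have [y' sc'] := HA x t t12.
have vs0 := scale_vd_gt0 A1 sc; have vt0 := scale_vd_gt0 A1 sc'.
case: sc => r0 _ _ _ [_ s1 _ s2]; case: sc' => r0' _ _ _ [t1 _ t2 _].
set r := rho x y in r0 s1 s2; set r' := rho x y' in r0' t1 t2.
have v0 := v_gt0 x r0; have v0' := v_gt0 x r0'.
have e1 : 1 <= s / t by rewrite ler_pdivlMr// mul1r.
have E1 : 1 <= (s / t) ^+ (a * b) by rewrite exprn_ege1.
suff H : v x r ^+ a.+1 <= D * (s / t) ^+ (a * b) * v x r' ^+ a.+1.
  apply: le_trans (_ : (A * v x r) ^+ a.+1 <= _).
    by rewrite lerXn2r// nnegrE ltW// mulr_gt0.
  rewrite exprMn.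
  apply: le_trans (_ : A ^+ a.+1 * (D * (s / t) ^+ (a * b) * (A * vd x t) ^+ a.+1) <= _); last first.
    by rewrite [(A * vd x t) ^+ _]exprMn le_eqVlt; apply/orP; left; apply/eqP; ring.
  rewrite ler_pM2l ?exprn_gt0//; apply: le_trans H _.
  rewrite ler_pM2l ?mulr_gt0//; last by lra.
  by rewrite lerXn2r// nnegrE ltW// mulr_gt0.
(* The radii matching [t] and [s] need not be ordered like them; if [r < r'], monotonicity
   suffices. *)
have [rr|/ltW rr] := leP r r'.
  apply: le_trans (_ : 1 * v x r' ^+ a.+1 <= _).
    by rewrite mul1r lerXn2r ?nnegrE ?(ltW v0) ?(ltW v0')//; exact: v_mono.
  by rewrite ler_pM2r ?exprn_gt0// mulr_ege1.
have q : r / r' <= A ^+ 2 * (s / t) ^+ b * (v x r' / v x r).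
  rewrite ler_pdivrMr// expr_div_n.
  have -> : A ^+ 2 * (s ^+ b / t ^+ b) * (v x r' / v x r) * r' =
     (A * s ^+ b) * (A * (r' * v x r')) / (t ^+ b * v x r).
    by field; rewrite !gt_eqF// exprn_gt0.
  rewrite ler_pdivlMr ?mulr_gt0 ?exprn_gt0//.
  have -> : r * (t ^+ b * v x r) = (r * v x r) * t ^+ b by ring.
  by rewrite ler_pM// ?mulr_ge0 ?exprn_ge0// ltW.
have := v_pow x r0' rr.
have w0 : 0 < v x r' / v x r by rewrite divr_gt0.
have H : (2 * (r / r')) ^+ a <= D * (s / t) ^+ (a * b) * (v x r' / v x r) ^+ a.
  have -> : D * (s / t) ^+ (a * b) * (v x r' / v x r) ^+ a =
    (2 * (A ^+ 2 * (s / t) ^+ b * (v x r' / v x r))) ^+ a.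
    by rewrite /D mulnC exprM -!exprMn !mulrA.
  have rr0 : 0 < r / r' by rewrite divr_gt0.
  rewrite lerXn2r ?nnegrE ?ler_pM2l// mulr_ge0 ?(ltW rr0)//.
  by apply: le_trans q; rewrite ltW.
move=> /le_trans/(_ (ler_wpM2r (ltW v0') H)) G.
rewrite exprS; apply: le_trans (ler_wpM2r (exprn_ge0 a (ltW v0)) G) _.
rewrite [(v x r' / _) ^+ a]expr_div_n le_eqVlt; apply/orP; left; apply/eqP.
move: ((s / t) ^+ _) => w; rewrite exprS; field.
by rewrite expf_eq0 gt_eqF ?andbF.
Qed.

Lemma small_ball A c : 1 <= A -> 0 < c -> c <= 1 ->
  exists2 lam, 0 < lam & forall x s y, 0 < s -> scale A x s y ->
    forall z, d x z < lam * s -> rho x z < c * rho x y.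
Proof.
move=> A1 c0 c1; have A0 : 0 < A by lra.
(* Chosen so that [e * A * (r * v x r)], with [r = rho x y], equals the lower bound for
   [c * r * v x (c * r)] given by doubling. *)
pose e := c * (c / 2) ^+ a / A.
have e0 : 0 < e by rewrite !mulr_gt0 ?exprn_gt0 ?invr_gt0// divr_gt0.
have e1 : e <= 1.
  rewrite ler_pdivrMr// mul1r; apply: le_trans A1.
  by rewrite mulr_ile1 ?exprn_ge0 ?exprn_ile1//; lra.
exists (e / 2) => [|x s y s0 [r0 _ _ _ [_ _ sb _]] z zs]; first by rewrite divr_gt0.
rewrite ltNge; apply/negP => far.
have cr0 : 0 < c * rho x y by rewrite mulr_gt0.
have p1 := le_trans (pv_mono x (ltW cr0) far) (phi_ge x z).
have cr : c * rho x y <= rho x y by rewrite ger_pMl.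
have p2 := v_pow x cr0 cr.
have sb0 : 0 < s ^+ b by rewrite exprn_gt0.
have p3 : phi x z < e ^+ b * s ^+ b.
  apply: le_lt_trans (d_ge _ _) _; rewrite -exprMn -exprMn ltrXn2r//.
  - by rewrite -lt0n.
  - by rewrite mulr_ge0.
  - by rewrite -ltr_pdivlMl// [_^-1 * _]mulrC mulrAC.
have p4 : e ^+ b <= e by rewrite -[leRHS]expr1 ler_wiXn2l// ltW.
have p5 : c * rho x y * v x (c * rho x y) < e * s ^+ b.
  by apply: le_lt_trans p1 (lt_le_trans p3 _); rewrite ler_pM2r.
have : e * s ^+ b <= e * (A * (rho x y * v x (rho x y))) by rewrite ler_pM2l.
have p6 : (c / 2) ^+ a * v x (rho x y) <= v x (c * rho x y).
  have c2 : 0 < (c / 2) ^+ a by rewrite exprn_gt0// divr_gt0.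
  rewrite -ler_pdivlMl//; apply: le_trans p2 _.
  have -> : 2 * (rho x y / (c * rho x y)) = (c / 2)^-1 by field; rewrite !gt_eqF.
  by rewrite exprVn.
have : c * rho x y * ((c / 2) ^+ a * v x (rho x y)) <= c * rho x y * v x (c * rho x y).
  by rewrite ler_pM2l.
have -> : e * (A * (rho x y * v x (rho x y))) =
  c * rho x y * ((c / 2) ^+ a * v x (rho x y)).
  by rewrite /e; field; rewrite gt_eqF.
lra.
Qed.

End Doubling.

(** * Volumes and cutoff functions *)

Section Mass.
Context {R : realType} {V : countType} {nb : V -> seq V} {mu : V -> V -> R}.
Context (Gs : simple_graph nb) (Gmu : conductance nb mu).
Local Notation muv := (muv nb mu).
Local Notation muset := (muset nb mu).

Definition mass (A : set V) : R := fine (muset A).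

Lemma muset_ge0 A : (0 <= muset A)%E.
Proof. by apply: esum_ge0 => x _; rewrite lee_fin (muv_ge0 Gmu). Qed.

Lemma massE A : (muset A < +oo)%E -> muset A = (mass A)%:E.
Proof. by move=> fA; rewrite fineK// ge0_fin_numE// muset_ge0. Qed.

Lemma mass_ge0 A : 0 <= mass A.
Proof. by rewrite fine_ge0// muset_ge0. Qed.

Lemma le_mass_sum A U : (muset A < +oo)%E -> uniq U -> (forall x, x \in U -> A x) ->
  \sum_(x <- U) muv x <= mass A.
Proof.
move=> fA uU UA; have /(musetP Gmu) : (muset A <= (mass A)%:E)%E by rewrite massE.
exact.
Qed.

Lemma mass_le A c : (muset A < +oo)%E ->
  (forall U, uniq U -> (forall x, x \in U -> A x) -> \sum_(x <- U) muv x <= c) ->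
  mass A <= c.
Proof. by move=> fA H; rewrite -lee_fin -massE//; exact/(musetP Gmu). Qed.

Lemma muset_mono A B : A `<=` B -> (muset A <= muset B)%E.
Proof.
move=> AB; have := muset_ge0 B; case E: (muset B) => [c| |]//; rewrite ?leey// => _.
have /(musetP Gmu) H : (muset B <= c%:E)%E by rewrite E.
by apply/(musetP Gmu) => U uU UA; apply: H => // x /UA /AB.
Qed.

Lemma mass_mono A B : A `<=` B -> (muset B < +oo)%E -> mass A <= mass B.
Proof.
move=> AB fB; have fA := le_lt_trans (muset_mono AB) fB.
by rewrite -lee_fin -!massE//; exact: muset_mono.
Qed.

Lemma mass_approx A : (muset A < +oo)%E -> 0 < mass A -> exists U,
  [/\ uniq U, forall x, x \in U -> A x & mass A / 2 < \sum_(x <- U) muv x].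
Proof.
move=> fA A0; apply: contrapT => H.
suff : mass A <= mass A / 2 by lra.
apply: mass_le => // U uU UA; rewrite leNgt; apply/negP => ?.
by apply: H; exists U.
Qed.

End Mass.

(** * Doubling, packings and nets for resistance balls *)

Section ResistanceVolume.
Context {R : realType} {V : countType} {nb : V -> seq V} {mu : V -> V -> R}.
Context (Gs : simple_graph nb) (Gc : connected_graph nb) (Gmu : conductance nb mu).
Context (infV : infinite_set [set: V]).
Local Notation muv := (muv nb mu).
Local Notation rho := (Rmet nb mu).
Local Notation energy_le := (@energy_le R V nb mu).

Context (fin : forall (x : V) (s : R), 0 < s -> (vol nb mu rho x s < +oo)%E).

Definition vR x s := mass (nb := nb) (mu := mu) (ball_m rho x s).

Lemma vol_fin x s : (vol nb mu rho x s < +oo)%E.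
Proof.
apply: le_lt_trans (fin x (_ : 0 < Num.max s 1)); last by rewrite lt_max ltr01 orbT.
by apply: (muset_mono Gmu) => y; rewrite /ball_m/= lt_max => ->.
Qed.

Lemma volE x s : vol nb mu rho x s = (vR x s)%:E.
Proof. exact: (massE Gmu (vol_fin x s)). Qed.

Lemma vR_ge0 x s : 0 <= vR x s. Proof. exact: mass_ge0. Qed.

Lemma vR_sub x y s t : (forall z, rho y z < s -> rho x z < t) -> vR y s <= vR x t.
Proof. by move=> H; apply: (mass_mono Gmu); [move=> z; exact: H|exact: vol_fin]. Qed.

Lemma muv_le_vR x s : 0 < s -> muv x <= vR x s.
Proof.
move=> s0; have := @le_mass_sum R V nb mu Gmu (ball_m rho x s) [:: x] (vol_fin x s) isT.
rewrite big_seq1; apply => y; rewrite inE => /eqP ->.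
by rewrite /ball_m/= Rmetxx.
Qed.

Lemma vR_gt0 x s : 0 < s -> 0 < vR x s.
Proof. by move=> /(muv_le_vR x); apply: lt_le_trans; exact: muv_gt0. Qed.

Lemma vR_pow : VD nb mu rho -> exists2 a, (0 < a)%N & forall x s t, 0 < t -> t <= s ->
  vR x s <= (2 * (s / t)) ^+ a * vR x t.
Proof.
move=> [C [C0 HC]].
have [a' Ca'] : exists a, C <= 2 ^+ a.
  exists (Num.bound C); apply: le_trans (ltW (archi_boundP (ltW C0))) _.
  by rewrite -natrX ler_nat ltnW// ltn_expl.
(* The successor makes the exponent positive, which [1 <= alpha] will require. *)
pose a := a'.+1.
have Ca : C <= 2 ^+ a.
  by apply: le_trans Ca' _; rewrite exprS ler_peMl ?exprn_ge0//; lra.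
exists a => //.
have dbl x t : 0 < t -> vR x (2 * t) <= 2 ^+ a * vR x t.
  move=> t0; apply: le_trans (_ : C * vR x t <= _); last by rewrite ler_wpM2r// vR_ge0.
  by have := HC x t t0; rewrite !volE lee_fin.
have mono x s t : s <= t -> vR x s <= vR x t.
  by move=> st; apply: vR_sub => z zs; exact: lt_le_trans st.
(* Induction on the number of doublings from [t] to [s]; the extra factor 2 pays for the last,
   incomplete one. *)
have H k x s t : 0 < t -> t <= s -> s <= 2 ^+ k * t -> vR x s <= (2 * (s / t)) ^+ a * vR x t.
  elim: k s => [|k IH] s t0 ts sk.
    rewrite expr0 mul1r in sk; have -> : s = t by apply/eqP; rewrite eq_le sk ts.
    by rewrite divff ?gt_eqF// mulr1 ler_peMl ?vR_ge0// exprn_ege1//; lra.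
  have [s2|/ltW s2] := leP s (2 * t).
    apply: le_trans (mono _ _ _ s2) _; apply: le_trans (dbl _ _ t0) _.
    have st1 : 2 <= 2 * (s / t) by rewrite ler_peMr// ler_pdivlMr// mul1r.
    by rewrite ler_wpM2r ?vR_ge0// lerXn2r// nnegrE; lra.
  have -> : s = 2 * (s / 2) by field.
  apply: le_trans (dbl _ _ _) _; first by lra.
  apply: le_trans (_ : 2 ^+ a * ((2 * (s / 2 / t)) ^+ a * vR x t) <= _).
    rewrite ler_wpM2l ?exprn_ge0//; apply: IH => //; first by lra.
    by move: sk; rewrite exprS; lra.
  by rewrite mulrA -exprMn; have -> : 2 * (2 * (s / 2 / t)) = 2 * (2 * (s / 2) / t) by ring.
move=> x s t t0 ts; apply: (H (Num.bound (s / t))) => //.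
rewrite -ler_pdivrMr//; apply: le_trans (ltW (archi_boundP _)) _.
  by rewrite divr_ge0// ltW// (lt_le_trans t0).
by rewrite -natrX ler_nat ltnW// ltn_expl.
Qed.

Context (a : nat) (vpow : forall x s t, 0 < t -> t <= s ->
  vR x s <= (2 * (s / t)) ^+ a * vR x t).

(** Balls of radius [s] around points [8 * s] apart are disjoint by the quasi-triangle inequality.
    Each contains a finite set with more than half its volume, hence the factor 2. *)
Lemma packing (ys : seq V) (s kappa : R) : 0 < s -> 0 < kappa ->
  pairwise (fun y z => 8 * s <= rho y z) ys ->
  (forall y, y \in ys -> kappa <= vR y s) ->
  exists W, [/\ uniq W, forall w, w \in W -> exists2 y, y \in ys & rho y w < s &
    (size ys)%:R * kappa <= 2 * \sum_(w <- W) muv w].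
Proof.
move=> s0 k0; elim: ys => [_ _|y ys IH /=/andP[yys pys] Hk].
  by exists [::]; split => //; rewrite mul0r big_nil mulr0.
have [|W [uW HW SW]] := IH pys; first by move=> z zys; apply: Hk; rewrite inE zys orbT.
have [U [uU HU SU]] := mass_approx Gmu (vol_fin y s) (vR_gt0 y s0).
exists (U ++ W); split.
- rewrite cat_uniq uU uW andbT/=; apply/hasPn => w /HW[z zys zw]; apply/negP => /HU/= yw.
  have := allP yys _ zys; rewrite leNgt => /negP; apply.
  apply: le_lt_trans (Rmet_quasi Gs Gc Gmu y w z) _.
  by rewrite ltr_pM2l// gt_max yw (Rmet_sym Gs Gc Gmu) zw.
- move=> w; rewrite mem_cat => /orP[/HU yw|/HW[z zys zw]].
    by exists y => //; rewrite mem_head.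
  by exists z => //; rewrite inE zys orbT.
- rewrite big_cat/= mulrDr -addn1 natrD mulrDl mul1r addrC lerD//.
  have : kappa <= vR y s by apply: Hk; rewrite mem_head.
  by move: SU; rewrite -/(vR y s); lra.
Qed.

(** A maximal separated set of the annulus is a net. Doubling makes each small ball a fixed fraction
    of one large ball, so [packing] bounds its size independently of [x] and [r]. *)
Lemma net (M delta : R) : 1 <= M -> 0 < delta -> delta <= 1 ->
  exists N : nat, forall x r, 0 < r -> exists ys : seq V, [/\ (size ys <= N)%N,
    forall y, y \in ys -> r <= rho x y &
    forall y, r <= rho x y -> rho x y <= M * r -> exists2 z, z \in ys & rho y z < delta * r].
Proof.
move=> M1 d0 d1.
(* For [y] in the annulus, the ball of radius [9 M r] at [x] lies in that of radius [73 M r] at [y],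
   as [8 * 9 < 73]; [D] is the doubling cost from there down to radius [delta * r / 8]. *)
pose D : R := (2 * (73 * M * 8 / delta)) ^+ a.
have D0 : 0 < D by rewrite exprn_gt0// mulr_gt0// divr_gt0//; lra.
pose N := Num.bound (2 * D); exists N => x r r0.
pose s := delta * r / 8.
have s0 : 0 < s by rewrite divr_gt0// mulr_gt0.
have rM : r <= M * r by rewrite ler_peMl// ltW.
have sr : 8 * s <= r by rewrite /s mulrC divfK// ger_pMl.
(* [packing] would give [N <= 2 * D], against the choice of [N]. *)
have sep_size (ys : seq V) : pairwise (fun y z => 8 * s <= rho y z) ys ->
  (forall y, y \in ys -> r <= rho x y /\ rho x y <= M * r) -> size ys <> N.
  move=> pw ann sz.
  pose kappa := vR x (9 * (M * r)) / D.
  have Mr0 : 0 < M * r by lra.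
  have k0 : 0 < kappa by rewrite divr_gt0// vR_gt0//; lra.
  have [|W [uW HW SW]] := @packing ys s kappa s0 k0 pw.
    move=> y yys; rewrite ler_pdivrMr// [leRHS]mulrC.
    apply: le_trans (_ : vR y (73 * (M * r)) <= _).
      apply: vR_sub => z zx; apply: le_lt_trans (Rmet_quasi Gs Gc Gmu y x z) _.
      have : Num.max (rho y x) (rho x z) <= 9 * (M * r).
        by rewrite ge_max (ltW zx) andbT (Rmet_sym Gs Gc Gmu); have [_] := ann _ yys; lra.
      by lra.
    have := @vpow y (73 * (M * r)) s s0; rewrite /D.
    have -> : 73 * (M * r) / s = 73 * M * 8 / delta by rewrite /s; field; rewrite !gt_eqF.
    by apply; lra.
  have : \sum_(w <- W) muv w <= vR x (9 * (M * r)).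
    apply: (le_mass_sum Gmu) => //; first exact: vol_fin.
    move=> w /HW[y yys yw]; rewrite /ball_m/=.
    apply: le_lt_trans (Rmet_quasi Gs Gc Gmu x y w) _.
    have : Num.max (rho x y) (rho y w) <= M * r.
      by rewrite ge_max (ann _ yys).2 (le_trans (ltW yw))//; lra.
    by lra.
  move: SW; rewrite sz => SW SW2.
  have : N%:R * kappa <= 2 * (D * kappa).
    by apply: le_trans SW _; rewrite ler_pM2l// /kappa mulrC divfK ?gt_eqF.
  rewrite mulrA ler_pM2r// leNgt => /negP; apply.
  by apply: archi_boundP; rewrite mulr_ge0// ltW.
(* Greedy selection: as long as the annulus is not covered, an uncovered point extends the separated
   family. *)
have [//|[ys [sz pw ann]]] : (exists ys : seq V, [/\ (size ys <= N)%N,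
    forall y, y \in ys -> r <= rho x y &
    forall y, r <= rho x y -> rho x y <= M * r -> exists2 z, z \in ys & rho y z < delta * r])
  \/ (exists ys : seq V,
  [/\ size ys = N, pairwise (fun y z => 8 * s <= rho y z) ys &
     forall y, y \in ys -> r <= rho x y /\ rho x y <= M * r]); last first.
  by have := sep_size ys pw ann sz.
elim: (N) => [|n [[ys [sz H1 H2]]|[ys [sz pw ann]]]].
- by right; exists [::].
- by left; exists ys; split => //; exact: leqW.
have [cov|/existsNP[y /not_implyP[y1 /not_implyP[y2 H]]]] := pselect (forall y,
  r <= rho x y -> rho x y <= M * r -> exists2 z, z \in ys & rho y z < delta * r).
  by left; exists ys; split => //; [rewrite sz|move=> y /ann[]].
right; exists (y :: ys); split => /=; first by rewrite sz.
  rewrite pw andbT; apply/allP => z zys; rewrite leNgt; apply/negP => yz.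
  by apply: H; exists z => //; move: yz; rewrite /s [8 * _]mulrC divfK.
by move=> z; rewrite inE => /orP[/eqP ->|/ann].
Qed.

End ResistanceVolume.

Section CutoffFunction.
Context {R : realType} {V : countType} {nb : V -> seq V} {mu : V -> V -> R}.
Context (Gs : simple_graph nb) (Gc : connected_graph nb) (Gmu : conductance nb mu).
Context (infV : infinite_set [set: V]).
Local Notation muv := (muv nb mu).
Local Notation rho := (Rmet nb mu).
Local Notation energy_le := (@energy_le R V nb mu).
Local Notation vR := (@vR R V nb mu).

Context (fin : forall (x : V) (s : R), 0 < s -> (vol nb mu rho x s < +oo)%E).
Context (a : nat) (vpow : forall x s t, 0 < t -> t <= s ->
  vR x s <= (2 * (s / t)) ^+ a * vR x t).

Lemma sqr_between (x y z : R) : x <= y -> y <= z -> y ^+ 2 <= x ^+ 2 + z ^+ 2.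
Proof. by move=> xy yz; have [y0|/ltW y0] := leP 0 y; nra. Qed.

(** When the two minima are attained by different functions, their difference lies between [x - x']
    and [y - y']. *)
Lemma sqr_min (x y x' y' : R) :
  (Num.min x y - Num.min x' y') ^+ 2 <= (x - x') ^+ 2 + (y - y') ^+ 2.
Proof.
have [xy|/ltW xy] := leP x y; have [xy'|/ltW xy'] := leP x' y'.
- by rewrite lerDl sqr_ge0.
- by apply: sqr_between; rewrite ?lerB// lerD2l lerN2.
- by rewrite [leRHS]addrC; apply: sqr_between; lra.
- by rewrite lerDr sqr_ge0.
Qed.

Definition clip (t : R) : R := Num.max 0 (Num.min 1 t).

Lemma clip_ge0 t : 0 <= clip t. Proof. by rewrite le_max lexx. Qed.
Lemma clip_le1 t : clip t <= 1.
Proof. by rewrite ge_max ler01 ge_min lexx. Qed.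
Lemma clip1 t : 1 <= t -> clip t = 1.
Proof. by move=> t1; rewrite /clip min_l// max_r. Qed.
Lemma clip0 t : t <= 0 -> clip t = 0.
Proof. by move=> t0; rewrite /clip max_l// ge_min t0 orbT. Qed.

Lemma sqr_clip s t : (clip s - clip t) ^+ 2 <= (s - t) ^+ 2.
Proof.
wlog st : s t / s <= t.
  move=> H; have [/H//|/ltW/H] := leP s t.
  by rewrite -sqrrN opprB -[leRHS]sqrrN opprB.
have clipP u : [\/ u <= 0 /\ clip u = 0, 0 <= u <= 1 /\ clip u = u | 1 <= u /\ clip u = 1].
  have [u0|/ltW u0] := leP u 0; first by constructor 1; rewrite clip0.
  have [u1|/ltW u1] := leP 1 u; first by constructor 3; rewrite clip1.
  by constructor 2; rewrite /clip min_r// max_r// u0 u1.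
have : 0 <= clip t - clip s <= t - s.
  by case: (clipP s) => -[s1 ->]; case: (clipP t) => -[t1 ->]; lra.
move=> /andP[h1 h2]; rewrite -sqrrN opprB -[leRHS]sqrrN opprB.
by rewrite lerXn2r ?nnegrE//; lra.
Qed.

Lemma energy_le_clip f c k : energy_le f c ->
  energy_le (fun y => clip (k * f y)) (k ^+ 2 * c).
Proof.
move=> Ef; apply: (@energy_le1_dom _ _ _ _ Gmu) Ef _; first exact: sqr_ge0.
by move=> x y _; rewrite -exprMn mulrBr; exact: sqr_clip.
Qed.

(* The minimum of the potentials vanishing at the points of [ys]. *)
Lemma min_potentials x r delta (ys : seq V) : 0 < r -> 0 < delta -> delta <= 8^-1 ->
  (forall y, y \in ys -> r <= rho x y) ->
  exists g : V -> R, [/\ g x = 1, energy_le g ((size ys)%:R * (2 / r)) &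
    forall z y, z \in ys -> rho y z < delta * r -> g y <= 2^-1].
Proof.
move=> r0 d0 d8; elim: ys => [_|z ys IH Hys].
  exists (fun=> 1); split => // U uU; rewrite mul0r /energy_on big1 ?mulr0// => u _.
  by apply: big1 => w _; rewrite subrr !mulr0.
have [y yys|g [gx Eg Hg]] := IH; first by apply: Hys; rewrite inE yys orbT.
have rz : r <= rho x z by apply: Hys; rewrite mem_head.
have xz : x != z.
  by apply/eqP => xz; move: rz; rewrite xz Rmetxx leNgt r0.
have [f [fx fz Ef]] := Rmet_potential Gs Gc Gmu xz.
have {}Ef : energy_le f (2 / r).
  apply: energy_le_weak Ef; rewrite ler_pM2l// lef_pV2 ?posrE//.
  exact: lt_le_trans rz.
exists (fun y => Num.min (g y) (f y)); split.
- by rewrite gx fx minxx.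
- have -> : (size (z :: ys))%:R * (2 / r) = 1 * ((size ys)%:R * (2 / r)) + 1 * (2 / r).
    by rewrite /= -addn1 natrD; ring.
  apply: (energy_le_dom Gmu _ _ Eg Ef) => // u w _.
  by rewrite !mul1r; exact: sqr_min.
- move=> w y; rewrite inE ge_min => /orP[/eqP -> yz|wys yw]; last by rewrite (Hg w).
  apply/orP; right.
  (* Since [f z = 0], this yields [f y ^+ 2 <= 2 * delta], at most 1/4 by [delta <= 8^-1]. *)
  have := Rmet_holder Gs Gc Gmu y z Ef; rewrite fz subr0 => H.
  have {}H : f y ^+ 2 <= 2^-1 ^+ 2.
    apply: le_trans H _; apply: le_trans (_ : 2 / r * (delta * r) <= _).
      by rewrite ler_pM2l ?divr_gt0// ltW.
    have -> : 2 / r * (delta * r) = 2 * delta by field; rewrite gt_eqF.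
    by rewrite expr2; lra.
  have [fy|/ltW fy] := leP (f y) 0; first by apply: le_trans fy _.
  by rewrite -(@ler_pXn2r _ 2) ?nnegrE.
Qed.

Lemma muv_pos x : 0 < muv x. Proof. exact: (muv_gt0 Gs Gc Gmu). Qed.

Lemma Rmet_edge_p0 : cond_p0 nb mu ->
  exists2 M0 : R, 1 <= M0 & forall x y, y \in nb x -> rho x y <= M0 / muv x.
Proof.
move=> [p0 [p00 Hp]]; exists (1 + 2 / p0); first by rewrite lerDl divr_ge0// ltW.
move=> x y xy; apply: le_trans (Rmet_edge Gs Gc Gmu xy) _.
have [m0 _] := Gmu xy; have := Hp x y xy; rewrite ler_pdivlMr ?muv_pos// => pm.
have mx := muv_pos x.
apply: le_trans (_ : 2 / (p0 * muv x) <= _).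
  by rewrite ler_pM2l// lef_pV2 ?posrE// mulr_gt0.
have -> : (1 + 2 / p0) / muv x = (muv x)^-1 + 2 / (p0 * muv x).
  by field; rewrite !gt_eqF.
by rewrite lerDr invr_ge0 ltW.
Qed.

(** An edge from [u] has length at most [M0 / muv u], and [1 / muv u <= rho x u] unless [u = x]; so
    no edge leaving the ball jumps over the annulus. *)
Lemma edge_exit (M0 : R) x u w r : 1 <= M0 ->
  (forall x y, y \in nb x -> rho x y <= M0 / muv x) ->
  (muv x)^-1 <= r -> w \in nb u -> rho x u < r -> rho x w <= 8 * M0 * r.
Proof.
move=> M01 HM xr uw xu.
have r0 : 0 < r by apply: lt_le_trans xr; rewrite invr_gt0 muv_pos.
have M0r : r <= M0 * r by rewrite ler_peMl// ltW.
have [eux|nux] := eqVneq u x.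
  rewrite -eux; apply: le_trans (HM _ _ uw) _; rewrite eux.
  apply: le_trans (_ : M0 * r <= _); last by lra.
  by rewrite ler_pM2l//; lra.
apply: le_trans (Rmet_quasi Gs Gc Gmu x u w) _.
rewrite -mulrA ler_pM2l// ge_max; apply/andP; split; first by lra.
apply: le_trans (HM _ _ uw) _; rewrite ler_pM2l; last by lra.
by apply: le_trans (Rmet_ge Gs Gc Gmu nux) _; rewrite (Rmet_sym Gs Gc Gmu) ltW.
Qed.

(** The lower bound for the resistance across annuli: potentials vanishing on a net of the annulus
    around the ball have a minimum that can be cut off there. *)
Lemma cutoff : cond_p0 nb mu -> exists lam C : R, [/\ 0 < lam, lam <= 1, 0 < C &
  forall x r, 0 < r -> exists g : V -> R,
   [/\ forall y, 0 <= g y, forall y, g y <= 1,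
     forall y, rho x y < lam * r -> g y = 1,
     forall y, r <= rho x y -> g y = 0 & energy_le g (C / r)]].
Proof.
move=> /Rmet_edge_p0[M0 M01 HM].
pose M := 8 * M0.
have M1 : 1 <= M by rewrite /M; lra.
have d0 : (0 : R) < 8^-1 by rewrite invr_gt0.
have d1 : (8^-1 : R) <= 1 by lra.
have [N HN] := net Gs Gc Gmu infV fin vpow M1 d0 d1.
pose n : R := N%:R + 1.
have n1 : 1 <= n by rewrite lerDr.
have n0 : 0 < n by lra.
(* [g1] below has energy at most [8 n / r], so it drops by at most 1/2 within distance [r / (32 n)];
   doubling it before the final truncation raises the bound to [32 n / r]. *)
exists (32 * n)^-1, (32 * n); split => //.
- by rewrite invr_gt0 mulr_gt0.
- by rewrite invf_le1 ?mulr_gt0//; lra.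
- by rewrite mulr_gt0.
move=> x r r0.
(* At radii below [1 / muv x] the ball is the single point [x] and its indicator serves. *)
have [xr|rx] := leP (muv x)^-1 r; last first.
  have xx z : x != z -> r < rho x z.
    by move=> xz; apply: lt_le_trans rx (Rmet_ge Gs Gc Gmu xz).
  exists (fun y => (y == x)%:R); split => [y|y|y yx|y yx|].
  - by rewrite ler0n.
  - by case: eqP => //= _; rewrite ler01.
  - have [//|] := eqVneq y x; rewrite eq_sym => /xx ry; exfalso.
    have : (32 * n)^-1 * r <= r by rewrite ger_pMl// invf_le1 ?mulr_gt0//; lra.
    by lra.
  - have [e|//] := eqVneq y x.
    by move: yx; rewrite e Rmetxx leNgt r0.
  - apply: energy_le_weak (energy_le_indic Gs Gmu x).
    have mx := muv_pos x.
    apply: le_trans (_ : r^-1 <= _).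
      by rewrite -[leLHS]invrK lef_pV2 ?posrE ?invr_gt0// ltW.
    by rewrite -[leLHS]mul1r ler_pM2r ?invr_gt0//; lra.
have [ys [sz Hys cov]] := HN x r r0.
have [g0 [g0x Eg0 Hg0]] := min_potentials r0 d0 (lexx _) Hys.
have {}Eg0 : energy_le g0 (n * (2 / r)).
  apply: energy_le_weak Eg0; rewrite ler_pM2r ?divr_gt0// /n.
  by apply: le_trans (_ : N%:R <= _); [rewrite ler_nat|rewrite lerDl].
(* An edge leaving the ball ends in the covered annulus, where [g0 <= 1/2] and the truncation
   already vanishes; hence the extension by zero adds no energy. *)
pose g1 y := if rho x y < r then clip (2 * g0 y - 1) else 0.
have g1E u w : w \in nb u -> rho x u < r -> g1 w = clip (2 * g0 w - 1).
  move=> uw xu; rewrite /g1; case: ltP => // xw.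
  have [z zys wz] := cov w xw (edge_exit M01 HM xr uw xu).
  by rewrite clip0// subr_le0 -ler_pdivlMl// mulr1; exact: Hg0 wz.
have Eg1 : energy_le g1 (4 * (n * (2 / r))).
  apply: (@energy_le1_dom _ _ _ _ Gmu) Eg0 _ => // u w uw.
  have key u' w' : w' \in nb u' -> rho x u' < r ->
      (g1 u' - g1 w') ^+ 2 <= 4 * (g0 u' - g0 w') ^+ 2.
    move=> uw' xu; rewrite (g1E _ _ uw' xu) {1}/g1 xu.
    apply: le_trans (sqr_clip _ _) _; rewrite le_eqVlt; apply/orP; left; apply/eqP; ring.
  have [xu|xu] := ltP (rho x u) r; first exact: key.
  have [xw|xw] := ltP (rho x w) r.
    by rewrite -sqrrN opprB -[X in _ * X]sqrrN opprB; apply: key => //; rewrite -Gs.2.2.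
  by rewrite /g1 !ltNge xu xw/= subrr expr0n/= mulr_ge0 ?sqr_ge0.
have g1x : g1 x = 1 by rewrite /g1 Rmetxx r0 g0x clip1//; lra.
exists (fun y => clip (2 * g1 y)); split => [y|y|y yx|y yx|].
- exact: clip_ge0.
- exact: clip_le1.
- apply: clip1.
  have H := Rmet_holder Gs Gc Gmu x y Eg1; rewrite g1x in H.
  have {}H : (1 - g1 y) ^+ 2 <= 4^-1.
    apply: le_trans H _; apply: le_trans (_ : 4 * (n * (2 / r)) * ((32 * n)^-1 * r) <= _).
      by rewrite ler_wpM2l ?(ltW yx)// mulr_ge0// mulr_ge0 ?divr_ge0// ltW.
    have -> : 4 * (n * (2 / r)) * ((32 * n)^-1 * r) = 4^-1 by field; rewrite !gt_eqF.
    by [].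
  rewrite leNgt; apply/negP => g1y; nra.
- by rewrite /g1 ltNge yx/= mulr0 clip0.
- have := @energy_le_clip g1 _ 2 Eg1; apply: energy_le_weak.
  by rewrite le_eqVlt; apply/orP; left; apply/eqP; field; rewrite gt_eqF.
Qed.

End CutoffFunction.

(** * On-diagonal heat kernel *)

Section HeatKernel.
Context {R : realType} {V : countType} {nb : V -> seq V} {mu : V -> V -> R}.
Context (Gs : simple_graph nb) (Gmu : conductance nb mu).
Local Notation muv := (muv nb mu).
Local Notation cond := (@cond R V nb mu).
Local Notation energy_on := (@energy_on R V nb mu).
Local Notation energy_le := (@energy_le R V nb mu).
Context (mu0 : forall x, 0 < muv x) (o : V).

Definition markov (f : V -> R) (x : V) : R := \sum_(y <- nb x) p1 nb mu x y * f y.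

Definition hkto (k : nat) (x : V) : R := hk nb mu k x o.

Lemma h0E x : hkto 0 x = (x == o)%:R / muv o.
Proof. by rewrite /hkto /hk /=; case: eqP. Qed.

Lemma hSE k x : hkto k.+1 x = markov (hkto k) x.
Proof.
rewrite /hkto /hk /= mulr_suml; apply: eq_bigr => y _.
by rewrite mulrA.
Qed.

(** Graph balls around [o]. They carry the kernels of bounded time, so that all inner products
    become finite sums. *)
Fixpoint gball (k : nat) : seq V :=
  if k is k'.+1 then undup (gball k' ++ flatten (map nb (gball k'))) else [:: o].

Lemma gball_uniq k : uniq (gball k).
Proof. by case: k => //= k; exact: undup_uniq. Qed.

Lemma gballS k : {subset gball k <= gball k.+1}.
Proof. by move=> x xk; rewrite mem_undup mem_cat xk. Qed.

Lemma gball_nb k x : x \in gball k -> {subset nb x <= gball k.+1}.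
Proof.
move=> xk y xy; rewrite mem_undup mem_cat; apply/orP; right.
by apply/flattenP; exists (nb x) => //; exact: map_f.
Qed.

Lemma gball_sub i j : (i <= j)%N -> {subset gball i <= gball j}.
Proof.
move=> /subnK <-; elim: (j - i)%N => // k IH x /IH; exact: gballS.
Qed.

Definition supported (f : V -> R) (U : seq V) := forall x, x \notin U -> f x = 0.

Lemma supported_sub f U W : {subset U <= W} -> supported f U -> supported f W.
Proof. by move=> UW fU x xW; apply: fU; apply: contra xW => /UW. Qed.

Lemma h_supp k : supported (hkto k) (gball k).
Proof.
elim: k => [|k IH] x xk.
  by move: xk; rewrite inE h0E => /negbTE ->; rewrite mul0r.
rewrite hSE /markov big_seq big1// => y xy; rewrite IH ?mulr0//.
apply: contra xk => yk; apply: (gball_nb yk).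
by rewrite -Gs.2.2.
Qed.

Lemma h_ge0 k x : 0 <= hkto k x.
Proof.
elim: k x => [|k IH] x; first by rewrite h0E divr_ge0// ltW.
rewrite hSE sumr_ge0// => y _; rewrite mulr_ge0// /p1; case: ifP => // xy.
by rewrite divr_ge0 ?(ltW (mu0 _))//; have [/ltW] := Gmu xy.
Qed.

Lemma muv_markov x f U : uniq U -> supported f U ->
  muv x * markov f x = \sum_(y <- U) cond x y * f y.
Proof.
move=> uU fU; rewrite /markov mulr_sumr.
rewrite -(@sum_nb _ _ _ mu Gs x U f)//; last first.
  by move=> y _; apply: contraNT => /fU ->.
apply: eq_big_seq => y xy; rewrite /p1 /adj xy mulrA mulrCA divff ?mulr1//.
by rewrite gt_eqF.
Qed.

Definition ip (U : seq V) (f g : V -> R) := \sum_(x <- U) f x * g x * muv x.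

Lemma ip_markov U f g : uniq U -> supported f U ->
  ip U (markov f) g = \sum_(x <- U) \sum_(y <- U) cond x y * f y * g x.
Proof.
move=> uU fU; apply: eq_bigr => x _.
by rewrite mulrAC [markov _ _ * _]mulrC (muv_markov x uU fU) mulr_suml.
Qed.

Lemma ip_adjoint U f g : uniq U -> supported f U -> supported g U ->
  ip U (markov f) g = ip U f (markov g).
Proof.
move=> uU fU gU; rewrite ip_markov//.
have -> : ip U f (markov g) = ip U (markov g) f.
  by apply: eq_bigr => x _; rewrite [f x * _]mulrC.
rewrite ip_markov// exchange_big/=; apply: eq_bigr => x _; apply: eq_bigr => y _.
by rewrite (condC Gs Gmu) mulrAC.
Qed.

Section Window.
(** [U] stands in for the whole vertex set: summation over it is exact as long as the times involved
    stay within [N]. *)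
Context (N : nat) (U : seq V) (uU : uniq U) (UN : {subset gball N <= U}).

Lemma supportedU k f : (k <= N)%N -> supported f (gball k) -> supported f U.
Proof. by move=> kN; apply: supported_sub => x /(gball_sub kN)/UN. Qed.

Lemma h_suppU k : (k <= N)%N -> supported (hkto k) U.
Proof. by move=> kN; exact: supportedU kN (@h_supp k). Qed.

Lemma eq_ip f f' g : f =1 f' -> ip U f g = ip U f' g.
Proof. by move=> ff; apply: eq_bigr => x _; rewrite ff. Qed.

Lemma eq_ipr f g g' : g =1 g' -> ip U f g = ip U f g'.
Proof. by move=> gg; apply: eq_bigr => x _; rewrite gg. Qed.

(** Self-adjointness moves the steps of the walk one by one from the left factor to the right. *)
Lemma ip_h i j : (i + j <= N)%N -> ip U (hkto i) (hkto j) = hkto (i + j) o.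
Proof.
elim: i j => [|i IH] j ijN.
  have oU : o \in U by apply: UN; apply: (@gball_sub 0 N) => //; rewrite inE.
  rewrite /ip (bigD1_seq o)//= big1 ?addr0; last first.
    by move=> x /negbTE xo; rewrite h0E xo !mul0r.
  by rewrite h0E eqxx mul1r mulrAC mulVf ?mul1r ?gt_eqF.
rewrite (eq_ip _ (hSE i)) ip_adjoint//; [|apply: h_suppU; lia..].
by rewrite -(eq_ipr _ (hSE j)) IH ?addnS ?addSn//; lia.
Qed.

Lemma h_mass k : (k <= N)%N -> \sum_(x <- U) hkto k x * muv x = 1.
Proof.
elim: k => [_|k IH kN].
  have oU : o \in U by apply: UN; apply: (@gball_sub 0 N) => //; rewrite inE.
  rewrite (bigD1_seq o)//= big1 ?addr0; last first.
    by move=> x /negbTE xo; rewrite h0E xo !mul0r.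
  by rewrite h0E eqxx mul1r mulVf// gt_eqF.
rewrite -[RHS]IH; last exact: ltnW.
have kU := h_suppU (ltnW kN).
transitivity (\sum_(x <- U) \sum_(y <- U) cond x y * hkto k y).
  by apply: eq_bigr => x _; rewrite hSE mulrC (muv_markov x uU kU).
rewrite exchange_big/=; apply: eq_bigr => y _.
have [yk|/(h_supp (k := k)) hy] := boolP (y \in gball k); last first.
  by rewrite hy mul0r big1// => x _; rewrite mulr0.
rewrite -mulr_suml mulrC (muvE Gs uU); last first.
  by move=> z /(gball_nb yk)/(gball_sub kN)/UN.
by congr (_ * _); apply: eq_bigr => x _; rewrite (condC Gs Gmu).
Qed.

(** Summation by parts; [k < N] ensures that all neighbours of the support of [f] lie in [U], so
    [muv] is a full row sum there. *)
Lemma green k f g : (k < N)%N -> supported f (gball k) ->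
  ip U (fun x => f x - markov f x) g = energy_on U f g.
Proof.
move=> kN fk.
have fU : supported f U := supportedU (ltnW kN) fk.
have E x : x \in U -> (f x - markov f x) * g x * muv x =
    \sum_(y <- U) cond x y * (f x - f y) * g x.
  move=> xU; rewrite -mulr_suml; rewrite mulrAC; congr (_ * _).
  rewrite mulrBl [markov f x * _]mulrC (muv_markov x uU fU).
  under [RHS]eq_bigr do rewrite mulrBr.
  rewrite sumrB; congr (_ - _); rewrite -mulr_suml mulrC.
  have [xk|/fk ->] := boolP (x \in gball k); last by rewrite !mulr0.
  by rewrite (muvE Gs uU)// => y /(gball_nb xk)/(gball_sub kN)/UN.
rewrite /ip (eq_big_seq _ E) /energy_on.
set S := LHS.
have S' : S = \sum_(x <- U) \sum_(y <- U) cond x y * (f y - f x) * g y.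
  rewrite /S exchange_big/=; apply: eq_bigr => x _; apply: eq_bigr => y _.
  by rewrite (condC Gs Gmu).
suff -> : \sum_(x <- U) \sum_(y <- U) cond x y * ((f x - f y) * (g x - g y)) = S + S by lra.
rewrite {2}S' /S -big_split/=; apply: eq_bigr => x _; rewrite -big_split/=.
by apply: eq_bigr => y _; ring.
Qed.

(* Positivity of [1 + P]; together with [1 - P >= 0] it handles the parity of the walk. *)
Lemma ip_plus_ge0 k f : (k < N)%N -> supported f (gball k) ->
  0 <= ip U (fun x => f x + markov f x) f.
Proof.
move=> kN fk.
have fU : supported f U := supportedU (ltnW kN) fk.
have E x : x \in U -> (f x + markov f x) * f x * muv x =
    \sum_(y <- U) cond x y * (f x + f y) * f x.
  move=> xU; rewrite -mulr_suml; rewrite mulrAC; congr (_ * _).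
  rewrite mulrDl [markov f x * _]mulrC (muv_markov x uU fU).
  under [RHS]eq_bigr do rewrite mulrDr.
  rewrite big_split/=; congr (_ + _); rewrite -mulr_suml mulrC.
  have [xk|/fk ->] := boolP (x \in gball k); last by rewrite !mulr0.
  by rewrite (muvE Gs uU)// => y /(gball_nb xk)/(gball_sub kN)/UN.
rewrite /ip (eq_big_seq _ E).
set S := leRHS.
have S' : S = \sum_(x <- U) \sum_(y <- U) cond x y * (f y + f x) * f y.
  rewrite /S exchange_big/=; apply: eq_bigr => x _; apply: eq_bigr => y _.
  by rewrite (condC Gs Gmu).
suff : 0 <= S + S by lra.
rewrite {2}S' /S -big_split/=; apply: sumr_ge0 => x _; rewrite -big_split/=.
apply: sumr_ge0 => y _.
have -> : cond x y * (f x + f y) * f x + cond x y * (f y + f x) * f y =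
  cond x y * (f x + f y) ^+ 2 by ring.
by rewrite mulr_ge0 ?sqr_ge0// (cond_ge0 Gmu).
Qed.

End Window.

Lemma markovD f g x : markov (fun y => f y + g y) x = markov f x + markov g x.
Proof. by rewrite -big_split/=; apply: eq_bigr => y _; rewrite mulrDr. Qed.

Lemma markovB f g x : markov (fun y => f y - g y) x = markov f x - markov g x.
Proof. by rewrite -sumrB; apply: eq_bigr => y _; rewrite mulrBr. Qed.

Lemma ipDl U f g k : ip U (fun x => f x + g x) k = ip U f k + ip U g k.
Proof. by rewrite -big_split/=; apply: eq_bigr => x _; rewrite !mulrDl. Qed.

Lemma ipBl U f g k : ip U (fun x => f x - g x) k = ip U f k - ip U g k.
Proof. by rewrite -sumrB; apply: eq_bigr => x _; rewrite !mulrBl. Qed.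

Lemma ipDr U f g k : ip U k (fun x => f x + g x) = ip U k f + ip U k g.
Proof. by rewrite -big_split/=; apply: eq_bigr => x _; rewrite mulrDr mulrDl. Qed.

Lemma ipBr U f g k : ip U k (fun x => f x - g x) = ip U k f - ip U k g.
Proof. by rewrite -sumrB; apply: eq_bigr => x _; rewrite mulrBr mulrBl. Qed.

(** The [f_k] of the introduction is [hksum k.*2], and its value [c_k] at [o] is [hkpair k]. *)
Definition hksum (k : nat) (x : V) : R := hkto k x + hkto k.+1 x.
Definition hkpair (k : nat) : R := hkto k.*2 o + hkto k.*2.+1 o.

Lemma h2_supp k : supported (hksum k) (gball k.+1).
Proof.
move=> x xk; rewrite /hksum (h_supp xk) (h_supp (k := k)) ?addr0//.
by apply: contra xk; exact: gballS.
Qed.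

(** [(1 - P) (1 + P) = 1 - P^2], applied to the kernel at time [k]. *)
Lemma h2_green k N U g : uniq U -> (k.+2 <= N)%N -> {subset gball N <= U} ->
  energy_on U (hksum k) g = ip U (hkto k) g - ip U (hkto k.+2) g.
Proof.
move=> uU kN UN; rewrite -(green uU UN g kN (@h2_supp k)) -ipBl.
by apply: eq_ip => x; rewrite /hksum markovD -!hSE; ring.
Qed.

Lemma c_energy_on k N U : uniq U -> (k.+1.*2.+1 <= N)%N -> {subset gball N <= U} ->
  energy_on U (hksum k) (hksum k) = hkpair k - hkpair k.+1.
Proof.
move=> uU kN UN; rewrite (h2_green _ uU _ UN); last by lia.
rewrite /hksum !ipDr !(ip_h uU UN); [|lia..].
rewrite /hkpair ?(addnS, addSn, addnn, doubleS).
by ring.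
Qed.

Lemma h2_energy k : energy_le (hksum k) (hkpair k - hkpair k.+1).
Proof.
move=> W uW; pose U := undup (W ++ gball k.+1.*2.+1).
have uU : uniq U by exact: undup_uniq.
have UN : {subset gball k.+1.*2.+1 <= U}.
  by move=> x xN; rewrite mem_undup mem_cat xN orbT.
rewrite -(c_energy_on uU (leqnn _) UN); apply: (energy_on_sub Gmu) => //.
by move=> x xW; rewrite mem_undup mem_cat xW.
Qed.

Lemma c_decr k : hkpair k.+1 <= hkpair k.
Proof. by rewrite -subr_ge0; exact: energy_le_ge0 (@h2_energy k). Qed.

Lemma c_ge0 k : 0 <= hkpair k. Proof. by rewrite addr_ge0// h_ge0. Qed.

Lemma hB_supp i j : (i <= j)%N -> supported (fun x => hkto i x - hkto j x) (gball j).
Proof.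
move=> ij x xj; rewrite (h_supp xj) (h_supp (k := i)) ?subr0//.
by apply: contra xj; exact: gball_sub.
Qed.

(** With [u = h_k - h_(k+2)], the second difference of [hkpair] is [<u + P u, u>], nonnegative by
    [ip_plus_ge0]. *)
Lemma c_convex k : hkpair k.+1 - hkpair k.+2 <= hkpair k - hkpair k.+1.
Proof.
pose N := k.+2.*2.+1.
have uU := gball_uniq N; have UN : {subset gball N <= gball N} by [].
have s : supported (fun x => hkto k x - hkto k.+2 x) (gball k.+2) by apply: hB_supp; lia.
have := ip_plus_ge0 uU UN (_ : (k.+2 < N)%N) s; rewrite /N => /(_ ltac:(lia)).
rewrite ipDl ipBr !ipBl.
have M g : ip (gball N) (markov (fun x => hkto k x - hkto k.+2 x)) g =
    ip (gball N) (hkto k.+1) g - ip (gball N) (hkto k.+3) g.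
  by rewrite -ipBl; apply: eq_ip => x; rewrite markovB -!hSE.
rewrite ipBr !M !(ip_h uU UN); rewrite /N; [|lia..].
rewrite /hkpair ?(addnS, addSn, addnn, doubleS).
by lra.
Qed.

(** By convexity the decrement at [2 k] is the smallest of the [k + 1] decrements from [k] to [2 k],
    whose sum is at most [hkpair k]. *)
Lemma c_energy_decay k : (k.+1)%:R * (hkpair k.*2 - hkpair k.*2.+1) <= hkpair k.
Proof.
have mono i j : (i <= j)%N -> hkpair j - hkpair j.+1 <= hkpair i - hkpair i.+1.
  move=> /subnK <-; elim: (j - i)%N => // m IH; apply: le_trans IH.
  exact: c_convex.
(* The decrements are summed backwards from [2 k]; the second alternative only discards
   [m > k + 1]. *)
have tele m : m%:R * (hkpair k.*2 - hkpair k.*2.+1) <= hkpair (k.*2.+1 - m)%N - hkpair k.*2.+1 \/ (k.+1 < m)%N.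
  elim: m => [|m [IH|km]]; [by left; rewrite mul0r subn0 subrr| |by right; lia].
  have [mk|?] := leqP m.+1 k.+1; [left|by right].
  have H := @mono (k.*2.+1 - m.+1)%N k.*2 ltac:(lia).
  rewrite (_ : (k.*2.+1 - m.+1).+1 = k.*2.+1 - m)%N in H; last by lia.
  by rewrite -natr1 mulrDl mul1r; lra.
case: (tele k.+1) => [|]; last by rewrite ltnn.
rewrite (_ : (k.*2.+1 - k.+1 = k)%N); last by lia.
by have := c_ge0 k.*2.+1; lra.
Qed.

(** For [u = h_k - h_(k+1)], [<u + P u, u> >= 0] reads [h_2k - h_(2k+1) - h_(2k+2) + h_(2k+3) >= 0]
    at [o]; adding [c_decr] cancels the odd times. *)
Lemma h_even_decr k : hkto k.+1.*2 o <= hkto k.*2 o.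
Proof.
pose N := k.+1.*2.+1.
have uU := gball_uniq N; have UN : {subset gball N <= gball N} by [].
have s : supported (fun x => hkto k x - hkto k.+1 x) (gball k.+1) by apply: hB_supp; lia.
have := ip_plus_ge0 uU UN (_ : (k.+1 < N)%N) s; rewrite /N => /(_ ltac:(lia)).
rewrite ipDl ipBr !ipBl.
have M g : ip (gball N) (markov (fun x => hkto k x - hkto k.+1 x)) g =
    ip (gball N) (hkto k.+1) g - ip (gball N) (hkto k.+2) g.
  by rewrite -ipBl; apply: eq_ip => x; rewrite markovB -!hSE.
rewrite ipBr !M !(ip_h uU UN); rewrite /N; [|lia..].
have := c_decr k; rewrite /hkpair.
rewrite /hkpair ?(addnS, addSn, addnn, doubleS).
by lra.
Qed.

Lemma h2_mass k W : uniq W -> \sum_(x <- W) hksum k x * muv x <= 2.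
Proof.
move=> uW; pose U := undup (W ++ gball k.+1).
have uU : uniq U by exact: undup_uniq.
have UN : {subset gball k.+1 <= U}.
  by move=> x xN; rewrite mem_undup mem_cat xN orbT.
apply: le_trans (_ : \sum_(x <- U) hksum k x * muv x <= _).
  apply: sum_sub_seq => // [x xW|x]; first by rewrite mem_undup mem_cat xW.
  by rewrite mulr_ge0 ?addr_ge0 ?h_ge0// ltW.
under eq_bigr do rewrite mulrDl.
by rewrite big_split/= !(h_mass uU UN)//; lra.
Qed.

(** Cauchy-Schwarz by an edgewise mean inequality with weights [be / al] and [al / be]. *)
Lemma energy_on_cs U f g al be : 0 < al -> 0 < be ->
  energy_on U f f <= al ^+ 2 -> energy_on U g g <= be ^+ 2 ->
  energy_on U f g <= al * be.
Proof.
move=> a0 b0 Ef Eg.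
have H : 2 * energy_on U f g <= be / al * energy_on U f f + al / be * energy_on U g g.
  rewrite /energy_on !(mulrCA _ 2^-1) -mulrDr ler_pM2l// !mulr_sumr -big_split/=.
  apply: ler_sum => x _; rewrite !mulr_sumr -big_split/=; apply: ler_sum => y _.
  rewrite !(mulrCA _ (cond x y)) -mulrDr ler_wpM2l ?(cond_ge0 Gmu)//.
  set X := f x - f y; set Y := g x - g y.
  rewrite -subr_ge0.
  have -> : be / al * (X * X) + al / be * (Y * Y) - 2 * (X * Y) =
     (be * X - al * Y) ^+ 2 / (al * be) by field; rewrite !gt_eqF.
  by rewrite divr_ge0 ?sqr_ge0// ltW// mulr_gt0.
have h1 : be / al * energy_on U f f <= be / al * al ^+ 2 by rewrite ler_pM2l// divr_gt0.
have hksum' : al / be * energy_on U g g <= al / be * be ^+ 2 by rewrite ler_pM2l// divr_gt0.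
have e1 : be / al * al ^+ 2 = al * be by field; rewrite gt_eqF.
have e2 : al / be * be ^+ 2 = al * be by field; rewrite gt_eqF.
by lra.
Qed.

Lemma h_test_decay k N U g al be : uniq U -> {subset gball N <= U} ->
  (k.*2.+2 <= N)%N -> 0 < al -> 0 < be -> hkpair k.*2 - hkpair k.*2.+1 <= al ^+ 2 ->
  energy_le g (be ^+ 2) ->
  ip U (hkto k.*2) g - al * be <= ip U (hkto k.+1.*2) g.
Proof.
move=> uU UN kN a0 b0 ca Eg; rewrite lerBlDr -lerBlDl doubleS.
rewrite -(h2_green _ uU kN UN); apply: energy_on_cs => //; last exact: Eg.
exact: le_trans (@h2_energy k.*2 _ uU) ca.
Qed.

(* Cauchy-Schwarz in the form [2 u g <= 2 W u ^ 2 + g ^ 2 / (2 W)] with [u = hkto (2 k)]. *)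
Lemma h_lower k U g W : uniq U -> {subset gball k.*2.*2 <= U} -> 0 < W ->
  \sum_(x <- U) g x ^+ 2 * muv x <= W -> 2^-1 <= ip U (hkto k.*2) g ->
  (4 * W)^-1 <= hkto k.*2.*2 o.
Proof.
move=> uU UN W0 gW T.
have <- : ip U (hkto k.*2) (hkto k.*2) = hkto k.*2.*2 o.
  by rewrite (ip_h uU UN) ?addnn.
set b := ip U (hkto k.*2) (hkto k.*2).
have H : 2 * ip U (hkto k.*2) g <= 2 * W * b + (2 * W)^-1 * \sum_(x <- U) g x ^+ 2 * muv x.
  rewrite /b /ip !mulr_sumr -big_split/=; apply: ler_sum => x _.
  rewrite -subr_ge0; set X := hkto _ x; set Y := g x; set m := muv x.
  have -> : 2 * W * (X * X * m) + (2 * W)^-1 * (Y ^+ 2 * m) - 2 * (X * Y * m) =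
    (2 * W * X - Y) ^+ 2 * m / (2 * W) by field; rewrite gt_eqF.
  have m0 : 0 <= m by exact: ltW (mu0 x).
  by apply: divr_ge0; apply: mulr_ge0 => //; [exact: sqr_ge0|exact: ltW].
have : (2 * W)^-1 * \sum_(x <- U) g x ^+ 2 * muv x <= 2^-1.
  by rewrite ler_pdivrMl ?mulr_gt0//; lra.
by move=> ?; rewrite -div1r ler_pdivrMr ?mulr_gt0//; lra.
Qed.

End HeatKernel.

Section Roots.
Context {R : realType}.

Lemma powR_invn (x : R) m : (0 < m)%N -> 0 <= x -> (x `^ m%:R^-1) ^+ m = x.
Proof.
move=> m0 x0; rewrite -powR_mulrn ?powR_ge0// -powRrM mulVf ?powRr1//.
by rewrite pnatr_eq0 -lt0n.
Qed.

(** A discrete substitute for integrating [t ^ (1/m - 1)]: it makes the sum of these terms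
    telescope. It follows from [1 = p ^+ m - q ^+ m <= (p - q) * m * p ^+ m.-1]. *)
Lemma root_increment m k : (0 < m)%N ->
  k.+1%:R `^ m%:R^-1 / k.+1%:R <= m%:R * (k.+1%:R `^ m%:R^-1 - k%:R `^ m%:R^-1) :> R.
Proof.
move=> m0; set p := _.+1%:R `^ _; set q := k%:R `^ _.
have p0 : 0 < p by rewrite powR_gt0.
have q0 : 0 <= q by exact: powR_ge0.
have pm : p ^+ m = k.+1%:R by exact: powR_invn.
have qm : q ^+ m = k%:R by exact: powR_invn.
have qp : q <= p.
  by rewrite -(@ler_pXn2r _ m) ?nnegrE ?(ltW p0)// pm qm ler_nat.
have H : 1 <= (p - q) * (m%:R * p ^+ m.-1).
  have : p ^+ m - q ^+ m = 1 by rewrite pm qm -natr1 addrAC subrr add0r.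
  rewrite subrXX => E; rewrite -[leLHS]E ler_wpM2l ?subr_ge0//.
  apply: le_trans (_ : \sum_(i < m) p ^+ m.-1 <= _); last first.
    by rewrite sumr_const card_ord mulr_natl.
  apply: ler_sum => i _.
  have -> : p ^+ m.-1 = p ^+ (m.-1 - i) * p ^+ i.
    by rewrite -exprD subnK// -ltnS prednK.
  rewrite ler_wpM2l ?exprn_ge0 ?(ltW p0)//.
  by rewrite lerXn2r// nnegrE ltW.
rewrite ler_pdivrMr// -pm -(prednK m0) exprS.
have -> : m.-1.+1%:R * (p - q) * (p * p ^+ m.-1) = p * ((p - q) * (m.-1.+1%:R * p ^+ m.-1)) by ring.
by rewrite prednK// ler_peMr// ltW.
Qed.

End Roots.

(** * Two-sided heat kernel bounds from volume and resistance *)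

Section HeatKernelBounds.
Context {R : realType} {V : countType} {nb : V -> seq V} {mu : V -> V -> R}.
Context (Gs : simple_graph nb) (Gc : connected_graph nb) (Gmu : conductance nb mu).
Context (infV : infinite_set [set: V]).
Local Notation muv := (muv nb mu).
Local Notation rho := (Rmet nb mu).
Local Notation energy_le := (@energy_le R V nb mu).
Local Notation vR := (@vR R V nb mu).
Local Notation hkto := (@hkto R V nb mu).
Local Notation hksum := (@hksum R V nb mu).
Local Notation hkpair := (@hkpair R V nb mu).

Context (fin : forall (x : V) (s : R), 0 < s -> (vol nb mu rho x s < +oo)%E).
Context (a : nat) (vpow : forall x s t, 0 < t -> t <= s ->
  vR x s <= (2 * (s / t)) ^+ a * vR x t).
Context (Gp0 : cond_p0 nb mu).

Let mu0 x : 0 < muv x := muv_gt0 Gs Gc Gmu x infV.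

(* [W x k] stands for the volume of the [d]-ball of radius [k ^ (1 / beta)]. *)
Context (W : V -> nat -> R) (A D : R).
Hypothesis A_ge1 : 1 <= A.
Hypothesis D_gt0 : 0 < D.
Hypothesis W_scale : forall x k, (0 < k)%N -> exists r,
  [/\ 0 < r, k%:R <= A * (r * vR x r), r * vR x r <= A * k%:R,
      vR x r <= A * W x k & W x k <= A * vR x r].
Hypothesis W_growth : forall x k n, (0 < k)%N -> (k <= n)%N ->
  W x n ^+ a.+1 <= D * (n%:R / k%:R) ^+ a * W x k ^+ a.+1.

Lemma W_gt0 x k : (0 < k)%N -> 0 < W x k.
Proof.
move=> /(W_scale x)[r [r0 _ _ H _]].
have := lt_le_trans (vR_gt0 Gs Gc Gmu infV fin x r0) H.
by rewrite pmulr_rgt0// (lt_le_trans ltr01 A_ge1).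
Qed.

Lemma c_upper : exists2 C, 1 <= C & forall o k, hkpair o k <= C / W o k.+1.
Proof.
have A1 := A_ge1.
have A0 : 0 < A by lra.
exists ((6 + 4 * A) * A) => [|o k]; first by nra.
have W0 := W_gt0 o (ltn0Sn k).
have [r [r0 _ rV _ WV]] := W_scale o (ltn0Sn k).
set v := vR o r in rV WV.
have v0 : 0 < v by exact: (vR_gt0 Gs Gc Gmu infV fin).
have c0 := c_ge0 Gmu mu0 o k.
(* Were the kernel above [3 / v] on the whole ball, its mass there would exceed 2. *)
have [y [yr hy]] : exists y, rho o y < r /\ hksum o k.*2 y <= 3 / v.
  apply: contrapT => H.
  suff : v <= v / 3 * 2 by lra.
  apply: (mass_le Gmu); first exact: (vol_fin Gmu fin).
  move=> U uU UB; have := h2_mass Gs Gmu mu0 o k.*2 uU => M.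
  apply: le_trans (_ : v / 3 * \sum_(x <- U) hksum o k.*2 x * muv x <= _); last first.
    have v3 : 0 <= v / 3 by lra.
    by rewrite ler_wpM2l.
  rewrite mulr_sumr big_seq [leRHS]big_seq; apply: ler_sum => x xU.
  rewrite mulrA ler_peMl ?(ltW (mu0 x))//.
  rewrite -ler_pdivrMl ?divr_gt0// mulr1 invf_div leNgt; apply/negP => hx.
  by apply: H; exists x; split; [exact: UB|exact: ltW].
have Hh := Rmet_holder Gs Gc Gmu o y (@h2_energy _ _ _ _ Gs Gmu mu0 o k.*2).
have hyg0 : 0 <= hksum o k.*2 y by rewrite addr_ge0// h_ge0.
rewrite -/(hkpair o k) in Hh.
set z := hksum o k.*2 y in hy hyg0 Hh.
set x := hkpair o k in c0 *.
have ex : hksum o k.*2 o = x by [].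
rewrite ex in Hh.
have dec := c_energy_decay Gs Gmu mu0 o k; rewrite -/x in dec.
have k0 : (0 : R) < k.+1%:R by rewrite ltr0n.
have E : (hkpair o k.*2 - hkpair o k.*2.+1) * rho o y <= x / k.+1%:R * r.
  apply: ler_pM; rewrite ?(Rmet_ge0 Gs Gc Gmu) ?(ltW yr)//.
    by rewrite subr_ge0 (c_decr Gs Gmu mu0).
  by rewrite ler_pdivlMr// mulrC.
have rk : r / k.+1%:R <= A / v.
  by rewrite ler_pdivrMr// mulrAC ler_pdivlMr.
have {}E : (x - z) ^+ 2 <= x * (A / v).
  by apply: le_trans Hh (le_trans E _); rewrite -mulrA ler_wpM2l// mulrC.
(* If [x] were larger, [z <= 3 / v] would be below [x / 2], and [(x - z)^2 <= x * A / v] would force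
   [x < 4 * A / v]. *)
have xv : x <= (6 + 4 * A) / v.
  rewrite leNgt; apply/negP => xl.
  have iv : 0 < v^-1 by rewrite invr_gt0.
  set w := v^-1 in xl iv hy E.
  have z2 : z < x / 2 by nra.
  have : (x / 2) ^+ 2 < (x - z) ^+ 2 by nra.
  by nra.
apply: le_trans xv _; rewrite -mulrA ler_pM2l; last by lra.
by rewrite ler_pdivlMr// mulrC ler_pdivrMr// [A * _]mulrC mulrC.
Qed.

Lemma h_lower_bound : exists2 C, 0 < C & forall o n, (0 < n)%N -> C / W o n <= hkto o n.*2 o.
Proof.
have A1 := A_ge1; have D0 := D_gt0.
have A0 : 0 < A by lra.
have [C2 C21 Hc] := c_upper.
have C20 : 0 < C2 by lra.
have [lam [Cc [lam0 lam1 Cc0 Hcut]]] := cutoff Gs Gc Gmu infV fin vpow Gp0.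
(* Upper bound and volume growth bound the energy of [f_k] by a multiple of
   [(k+1) ^ (-2 + 1/(a+1))]; its square root has exponent [-1 + 1/m], which [root_increment]
   sums. *)
pose m := (2 * a.+1)%N.
have m0 : (0 < m)%N by [].
pose C3 := C2 * (D + 1).
have C30 : 0 < C3 by rewrite mulr_gt0// addr_gt0.
pose Q : R := m%:R ^+ 2 * C3 * Cc * A ^+ 2.
have mR : (0 : R) < m%:R by rewrite ltr0n.
have Q0 : 0 < Q by rewrite /Q (mulr_gt0 (mulr_gt0 (mulr_gt0 _ C30) Cc0))// exprn_gt0.
(* The total loss below is [be * sq * m], whose square is at most [Q / B], hence less than 1/4. *)
pose B : R := 4 * Q + 1.
have B1 : 1 <= B by rewrite /B; lra.
have B0 : 0 < B by lra.
exists (4 * ((2 * B) ^+ a * A))^-1 => [|o n n0].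
  by rewrite invr_gt0 !mulr_gt0 ?exprn_gt0// mulr_gt0.
have W0 := W_gt0 o n0.
have [r [r0 nr _ vW WV]] := W_scale o n0.
have v0 := vR_gt0 Gs Gc Gmu infV fin o r0.
set w := W o n in W0 vW WV *; set v := vR o r in nr vW WV v0.
have Br0 : 0 < B * r by rewrite mulr_gt0.
have [g [g0 g1 gin gout Eg]] := Hcut o (B * r) Br0.
(* Graph radius [4 n], since Cauchy-Schwarz will pair the kernel at time [2 n] with itself. *)
pose U := gball (nb := nb) o n.*2.*2.
have uU : uniq U by exact: gball_uniq.
have UN : {subset gball (nb := nb) o n.*2.*2 <= U} by [].
have nR : (0 : R) < n%:R by rewrite ltr0n.
pose kap (k : nat) : R := k%:R `^ m%:R^-1.
have kapn : 0 < kap n by exact: powR_gt0.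
have kap0 k : 0 <= kap k by exact: powR_ge0.
have kapm k : kap k ^+ m = k%:R by exact: powR_invn.
pose S2 := C3 * (n%:R / w); have S20 : 0 < S2 by rewrite mulr_gt0// divr_gt0.
pose sq := Num.sqrt S2; have sq0 : 0 < sq by rewrite sqrtr_gt0.
pose be := Num.sqrt (Cc / (B * r)).
have be0 : 0 < be by rewrite sqrtr_gt0 divr_gt0.
have beE : be ^+ 2 = Cc / (B * r) by rewrite sqr_sqrtr// ltW// divr_gt0.
pose al k := sq * (kap k.+1 / k.+1%:R / kap n).
have al0 k : 0 < al k.
  by rewrite mulr_gt0// !divr_gt0// powR_gt0// ltr0n.
have alP k : (k < n)%N -> hkpair o k.*2 - hkpair o k.*2.+1 <= al k ^+ 2.
  move=> kn; set X := _ - _.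
  have X0 : 0 <= X by rewrite subr_ge0 (c_decr Gs Gmu mu0).
  have K0 : (0 : R) < k.+1%:R by rewrite ltr0n.
  have Wk0 := W_gt0 o (ltn0Sn k).
  have XC : X <= C2 / (k.+1%:R * W o k.+1).
    rewrite invfM [_^-1 * _]mulrC mulrA ler_pdivlMr// mulrC.
    exact: le_trans (c_energy_decay Gs Gmu mu0 o k) (Hc o k).
  have G := W_growth o (ltn0Sn k) kn; rewrite -/w in G.
  (* Both sides are raised to the power [a + 1] because [W_growth] speaks of these powers. *)
  rewrite -(@ler_pXn2r _ a.+1)// ?nnegrE ?exprn_ge0 ?(ltW (al0 k))//.
  apply: le_trans (_ : (C2 / (k.+1%:R * W o k.+1)) ^+ a.+1 <= _).
    by rewrite lerXn2r// nnegrE (le_trans X0).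
  have -> : al k ^+ 2 ^+ a.+1 = S2 ^+ a.+1 * (k.+1%:R / k.+1%:R ^+ m / n%:R).
    rewrite -exprM -/m /al exprMn; congr (_ * _).
      by rewrite exprM sqr_sqrtr// ltW.
    by rewrite !expr_div_n !kapm.
  have -> : S2 ^+ a.+1 = (C2 ^+ a.+1 * (D + 1) ^+ a.+1) * (n%:R ^+ a.+1 / w ^+ a.+1).
    by rewrite /S2 /C3 !exprMn exprVn.
  rewrite expr_div_n exprMn.
  set Wp := W o k.+1 ^+ _ in G *; set wp := w ^+ _ in G *.
  have Wp0 : 0 < Wp by exact: exprn_gt0.
  have wp0 : 0 < wp by exact: exprn_gt0.
  set K : R := k.+1%:R in K0 G *.
  have Kp0 : 0 < K ^+ a.+1 by exact: exprn_gt0.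
  have Ka0 : 0 < K ^+ a by exact: exprn_gt0.
  rewrite ler_pdivrMr ?mulr_gt0//.
  have -> : (C2 ^+ a.+1 * (D + 1) ^+ a.+1) * (n%:R ^+ a.+1 / wp) * (K / K ^+ m / n%:R) * (K ^+ a.+1 * Wp) =
     (C2 ^+ a.+1 * (D + 1) ^+ a.+1) / wp * ((n%:R / K) ^+ a * Wp).
    rewrite /m mul2n -addnn exprD expr_div_n !exprS; field.
    by rewrite !gt_eqF.
  rewrite -(mulrA (C2 ^+ _)) -(mulrA (C2 ^+ _)) ler_peMr ?exprn_ge0//; first exact: ltW.
  apply: le_trans (_ : (D + 1) ^+ a.+1 / wp * (wp / D) <= _); last first.
    rewrite ler_pM2l ?divr_gt0 ?exprn_gt0//; last by lra.
    by rewrite ler_pdivrMr// mulrC mulrA.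
  have -> : (D + 1) ^+ a.+1 / wp * (wp / D) = (D + 1) ^+ a.+1 / D.
    by field; rewrite !gt_eqF.
  rewrite ler_pdivlMr// mul1r exprS; apply: le_trans (_ : D + 1 <= _); first by lra.
  by rewrite ler_peMr ?exprn_ege1//; lra.
have go : g o = 1 by apply: gin; rewrite Rmetxx mulr_gt0.
(* Each double step loses at most [al k * be], which is dominated by an increment of [kap]. *)
have T k : (k <= n)%N -> 1 - be * sq * m%:R * (kap k / kap n) <= ip (nb := nb) (mu := mu) U (hkto o k.*2) g.
  elim: k => [_|k IH kn].
    have -> : ip (nb := nb) (mu := mu) U (hkto o 0) g = 1.
      have oU : o \in U by apply: UN; apply: (@gball_sub _ _ o 0 _) => //; rewrite inE.
      rewrite /ip (bigD1_seq o)//= big1 ?addr0; last first.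
        by move=> x /negbTE xo; rewrite h0E xo !mul0r.
      by rewrite h0E eqxx go mulr1 mul1r mulVf// gt_eqF.
    rewrite gerBl; apply: mulr_ge0; last by rewrite divr_ge0// ltW.
    by rewrite !mulr_ge0// ltW.
  have kN : (k.*2.+2 <= n.*2.*2)%N.
    by rewrite -doubleS (leq_trans (_ : _ <= n.*2)%N) ?leq_double// -[leqRHS]addnn leq_addr.
  have Eg' : energy_le g (be ^+ 2) by rewrite beE.
  apply: le_trans (h_test_decay Gs Gmu mu0 uU UN kN (al0 k) be0 (alP k kn) Eg').
  have := IH (ltnW kn).
  suff : al k * be <= be * sq * m%:R * ((kap k.+1 - kap k) / kap n).
    have -> : (kap k.+1 - kap k) / kap n = kap k.+1 / kap n - kap k / kap n by rewrite mulrBl.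
    by lra.
  rewrite /al.
  have -> : sq * (kap k.+1 / k.+1%:R / kap n) * be = be * sq * (kap k.+1 / k.+1%:R / kap n) by ring.
  rewrite -[leRHS]mulrA ler_pM2l ?mulr_gt0// mulrA ler_pM2r ?invr_gt0//.
  exact: root_increment.
have Tn : 2^-1 <= ip (nb := nb) (mu := mu) U (hkto o n.*2) g.
  apply: le_trans (T n (leqnn n)); rewrite divff ?gt_eqF// mulr1.
  suff : be * sq * m%:R <= 2^-1 by lra.
  rewrite -(@ler_pXn2r _ 2) ?nnegrE ?mulr_ge0// ?(ltW be0) ?(ltW sq0)//.
  rewrite !exprMn beE sqr_sqrtr ?(ltW S20)// /S2.
  have nwr : n%:R <= A ^+ 2 * (w * r).
    apply: le_trans nr _; have -> : A ^+ 2 * (w * r) = A * (r * (A * w)) by ring.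
    by rewrite ler_pM2l// ler_pM2l.
  have -> : Cc / (B * r) * (C3 * (n%:R / w)) * m%:R ^+ 2 =
     (m%:R ^+ 2 * C3 * Cc) / B * (n%:R / (w * r)) by field; rewrite !gt_eqF.
  apply: le_trans (_ : (m%:R ^+ 2 * C3 * Cc) / B * A ^+ 2 <= _).
    have m2 : (0 : R) < m%:R ^+ 2 by exact: exprn_gt0.
    have c1 : 0 < m%:R ^+ 2 * C3 * Cc / B := divr_gt0 (mulr_gt0 (mulr_gt0 m2 C30) Cc0) B0.
    by rewrite ler_pM2l// ler_pdivrMr// mulr_gt0.
  rewrite mulrAC ler_pdivrMr// -/Q /B expr2; lra.
have gW : \sum_(x <- U) g x ^+ 2 * muv x <= (2 * B) ^+ a * A * w.
  apply: le_trans (_ : vR o (B * r) <= _); last first.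
    apply: le_trans (_ : (2 * B) ^+ a * v <= _).
      have := @vpow o (B * r) r r0; rewrite mulfK ?gt_eqF//; apply.
      by rewrite ler_peMl// ltW.
    by rewrite -mulrA ler_pM2l// exprn_gt0// mulr_gt0.
  rewrite (bigID (fun x => rho o x < B * r))/= [X in _ + X]big1 ?addr0; last first.
    by move=> x; rewrite -leNgt => /gout ->; rewrite expr0n mul0r.
  apply: le_trans (_ : \sum_(x <- U | rho o x < B * r) muv x <= _).
    apply: ler_sum => x _; rewrite ler_piMl ?(ltW (mu0 x))//.
    by rewrite exprn_ile1.
  rewrite -big_filter; apply: (le_mass_sum Gmu).
  - exact: (vol_fin Gmu fin).
  - exact: filter_uniq.
  - by move=> x; rewrite mem_filter => /andP[].
have BA0 : 0 < (2 * B) ^+ a * A * w by rewrite !mulr_gt0// exprn_gt0// mulr_gt0.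
have := h_lower Gs Gmu mu0 uU UN BA0 gW Tn.
have -> : (4 * ((2 * B) ^+ a * A * w))^-1 = (4 * ((2 * B) ^+ a * A))^-1 / w.
  by rewrite -invfM !mulrA.
move=> /le_trans; apply.
(* [h_lower] bounds the kernel at time [4 n]; monotonicity along even times brings this back to
   [2 n]. *)
have mono j : hkto o (n + j).*2 o <= hkto o n.*2 o.
  elim: j => [|j IH]; first by rewrite addn0.
  by apply: le_trans IH; rewrite addnS; exact: (h_even_decr Gs Gmu mu0).
by have := mono n; rewrite addnn.
Qed.

End HeatKernelBounds.

(** * Power gauges *)

Section PowerGauge.
Import numFieldNormedType.Exports.

Lemma continuous_norm_powR (R : realType) (p : R) : 0 < p ->
  continuous (fun t : R => `|t| `^ p).
Proof.
move=> p0 t; have [->|t0] := eqVneq t 0.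
  apply/cvgrPdist_lt => e e0.
  have ep0 : 0 < e `^ p^-1 by exact: powR_gt0.
  exists (e `^ p^-1) => // x; rewrite /= sub0r normrN => xe.
  rewrite normr0 powR0 ?gt_eqF// sub0r normrN ger0_norm ?powR_ge0//.
  have -> : e = (e `^ p^-1) `^ p by rewrite -powRrM mulVf ?gt_eqF// powRr1// ltW.
  by rewrite gt0_ltr_powR ?nnegrE ?powR_ge0.
apply: (@continuous_comp _ _ _ (fun t : R => `|t|) (fun t => t `^ p)).
  exact: norm_continuous.
have nt : `|t| \in `]0, +oo[ by rewrite in_itv/= andbT normr_gt0.
have /derivable1_diffP := @derivable_powR R 1 p _ nt.
exact: differentiable_continuous.
Qed.

Context {R : realType} (C p q : R).
Hypothesis C_gt0 : 0 < C.
Hypothesis q_gt0 : 0 < q.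
Hypothesis qp : q <= p.

(** Power [q] near 0 and power [p] at infinity. The absolute value gives continuity on the whole
    line. *)
Definition gauge (t : R) : R := C * Num.max (`|t| `^ p) (`|t| `^ q).
Definition gauge_inv (u : R) : R := Num.min (`|C^-1 * u| `^ p^-1) (`|C^-1 * u| `^ q^-1).

Let p_gt0 : 0 < p := lt_le_trans q_gt0 qp.

Lemma powR_anti (t x y : R) : 0 < x -> x <= y -> 0 <= t -> t <= 1 -> t `^ y <= t `^ x.
Proof.
move=> x0 xy t0 t1; have [->|tn0] := eqVneq t 0.
  by rewrite !powR0// gt_eqF// (lt_le_trans x0).
by apply: ger_powR => //; rewrite lt_neqAle eq_sym tn0 t0 t1.
Qed.

Lemma powR_ge1 (t x : R) : 0 <= x -> 1 <= t -> 1 <= t `^ x.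
Proof. by move=> x0 t1; rewrite -[leLHS](powRr0 t); exact: ler_powR. Qed.

Lemma powR_le1 (t x : R) : 0 <= x -> 0 <= t -> t <= 1 -> t `^ x <= 1.
Proof.
move=> x0 t0 t1; have : t `^ x <= 1 `^ x by apply: ge0_ler_powR; rewrite ?nnegrE.
by rewrite powR1.
Qed.

Lemma powRK (t x : R) : 0 < x -> 0 <= t -> (t `^ x) `^ x^-1 = t.
Proof. by move=> x0 t0; rewrite -powRrM divff ?gt_eqF// powRr1. Qed.

Lemma powRVK (t x : R) : 0 < x -> 0 <= t -> (t `^ x^-1) `^ x = t.
Proof. by move=> x0 t0; rewrite -powRrM mulVf ?gt_eqF// powRr1. Qed.

Lemma gauge_homeo : homeo_halfline gauge.
Proof.
have vqp : p^-1 <= q^-1 by rewrite lef_pV2.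
have vp0 : 0 < p^-1 by rewrite invr_gt0.
have vq0 : 0 < q^-1 by rewrite invr_gt0.
have cont r : 0 < r -> continuous (fun t : R => `|t| `^ r) by exact: continuous_norm_powR.
exists gauge_inv; split; [|split; [|split; [|split; [|split]]]].
- by move=> t _; rewrite mulr_ge0 ?(ltW C_gt0)// le_max powR_ge0.
- by move=> t _; rewrite le_min !powR_ge0.
- move=> t t0; rewrite /gauge_inv /gauge mulKf ?gt_eqF// ger0_norm; last first.
    by rewrite le_max powR_ge0.
  rewrite ger0_norm//; have [t1|/ltW t1] := leP t 1.
    rewrite max_r ?powR_anti// min_r; first exact: powRK.
    by apply: powR_anti => //; rewrite ?powR_ge0// powR_le1// ltW.
  rewrite max_l ?ler_powR// min_l; first exact: powRK.
  by apply: ler_powR => //; apply: powR_ge1 => //; exact: ltW.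
- move=> u u0; rewrite /gauge /gauge_inv.
  have s0 : 0 <= C^-1 * u by rewrite mulr_ge0// invr_ge0 ltW.
  rewrite [`|C^-1 * u|]ger0_norm// ger0_norm; last by rewrite le_min !powR_ge0.
  have [s1|/ltW s1] := leP (C^-1 * u) 1.
    rewrite min_r ?powR_anti// max_r; first by rewrite powRVK// mulVKf ?gt_eqF.
    by apply: powR_anti => //; rewrite ?powR_ge0// powR_le1// ltW.
  rewrite min_l ?ler_powR// max_l; first by rewrite powRVK// mulVKf ?gt_eqF.
  by apply: ler_powR => //; apply: powR_ge1 => //; exact: ltW.
- apply: continuous_subspaceT => t.
  rewrite (_ : gauge = fun t => C * ((`|t| `^ p + `|t| `^ q + `| `|t| `^ p - `|t| `^ q |) / 2)).
    apply: cvgM; first exact: cvg_cst.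
    apply: cvgM; last exact: cvg_cst.
    apply: cvgD; first by apply: cvgD; exact: cont.
    by apply: cvg_norm; apply: cvgB; exact: cont.
  by apply/funext => x; rewrite /gauge maxr_absE.
- apply: continuous_subspaceT => u.
  have contC r : 0 < r -> (fun u : R => `|C^-1 * u| `^ r) x @[x --> u] --> `|C^-1 * u| `^ r.
    move=> r0; apply: (@continuous_comp _ _ _ (fun u => C^-1 * u) (fun t => `|t| `^ r)).
      exact: mulrl_continuous.
    exact: cont.
  rewrite (_ : gauge_inv = fun u => (`|C^-1 * u| `^ p^-1 + `|C^-1 * u| `^ q^-1
      - `| `|C^-1 * u| `^ p^-1 - `|C^-1 * u| `^ q^-1 |) / 2).
    apply: cvgM; last exact: cvg_cst.
    apply: cvgB; first by apply: cvgD; exact: contC.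
    by apply: cvg_norm; apply: cvgB; exact: contC.
  by apply/funext => x; rewrite /gauge_inv minr_absE.
Qed.

End PowerGauge.

(** * The distance *)

Section ResistanceDistance.
Context {R : realType} {V : countType} {nb : V -> seq V} {mu : V -> V -> R}.
Context (Gs : simple_graph nb) (Gc : connected_graph nb) (Gmu : conductance nb mu).
Context (infV : infinite_set [set: V]) (Gp0 : cond_p0 nb mu).
Local Notation muv := (muv nb mu).
Local Notation rho := (Rmet nb mu).
Local Notation vR := (@vR R V nb mu).
Local Notation phiR := (phi rho vR).

Context (fin : forall (x : V) (s : R), 0 < s -> (vol nb mu rho x s < +oo)%E).
Context (unb : forall M : R, exists x y : V, M < rho x y).
Context (a : nat) (a_gt0 : (0 < a)%N) (vpow : forall x s t, 0 < t -> t <= s ->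
  vR x s <= (2 * (s / t)) ^+ a * vR x t).

Let mu0 x : 0 < muv x := muv_gt0 Gs Gc Gmu x infV.
Let rho_ge0 := Rmet_ge0 Gs Gc Gmu.
Let rho_sym := Rmet_sym Gs Gc Gmu.
Let rho_quasi := Rmet_quasi Gs Gc Gmu.
Let v_ge0 := @vR_ge0 R V nb mu Gmu.
Let v_gt0 := vR_gt0 Gs Gc Gmu infV fin.
Let v_sub := vR_sub Gmu fin.

(* The exponent is chosen so that [phi ^ (1 / beta)] satisfies the hypothesis of the chain metric. *)
Definition beta : nat := (Num.bound (quasi_cst a ^+ 2 : R)).+2.

Let K1 : 1 <= quasi_cst a :> R.
Proof.
by rewrite /quasi_cst mulr_ege1 ?lerDr ?exprn_ge0// mulr_ege1 ?exprn_ege1//; lra.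
Qed.

Lemma beta_quasi : quasi_cst a ^+ 2 <= 2 ^+ beta :> R.
Proof.
have K0 : 0 <= quasi_cst a ^+ 2 :> R by exact: sqr_ge0.
apply: le_trans (ltW (archi_boundP K0)) _.
by rewrite -natrX ler_nat ltnW// (leq_trans (ltn_expl _ (ltnSn 1)))// leq_exp2l// /beta ltnW.
Qed.

Definition qdist x y : R := phiR x y `^ beta%:R^-1.
Definition dist := chain_dist qdist.

Let phi0 x y : 0 <= phiR x y := phi_ge0 rho_ge0 v_ge0 x y.

Lemma qdistX x y : qdist x y ^+ beta = phiR x y.
Proof. exact: powR_invn. Qed.

Lemma qdist_ge0 x y : 0 <= qdist x y. Proof. exact: powR_ge0. Qed.

Lemma phi_xx x : phiR x x = 0. Proof. by rewrite /phi Rmetxx mul0r. Qed.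

Lemma phi_mu x y : rho x y * muv x <= phiR x y.
Proof.
have [->|nxy] := eqVneq x y; first by rewrite Rmetxx mul0r.
apply: le_trans (phi_ge rho_ge0 v_ge0 x y); rewrite ler_wpM2l//.
by apply: (muv_le_vR Gmu fin); exact: (Rmet_gt0 Gs Gc Gmu).
Qed.

(** Every ball at [x] has volume at least [muv x], and [rho x y >= 1 / muv x]. *)
Lemma phi_ge1 x y : x != y -> 1 <= phiR x y.
Proof.
move=> nxy; apply: le_trans (phi_mu x y).
have := Rmet_ge Gs Gc Gmu nxy; rewrite -(ler_pM2r (mu0 x)) mulVf//.
by rewrite gt_eqF.
Qed.

Lemma qdist_eq0 x y : qdist x y = 0 <-> x = y.
Proof.
split=> [E|->]; last by rewrite /qdist phi_xx powR0// invr_neq0// pnatr_eq0.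
apply/eqP/negPn/negP => /phi_ge1; rewrite -qdistX E expr0n/=; lra.
Qed.

Lemma qdist_sym x y : qdist x y = qdist y x.
Proof. by rewrite /qdist phi_sym. Qed.

(** Two uses of [phi_quasi] cost [quasi_cst a ^+ 2], which the choice of [beta] keeps below
    [2 ^+ beta]. *)
Lemma qdist_quasi x y z w :
  qdist x w <= 2 * Num.max (qdist x y) (Num.max (qdist y z) (qdist z w)).
Proof.
have max3 (u s t : R) : let m := Num.max u (Num.max s t) in [/\ u <= m, s <= m & t <= m].
  by rewrite /= !le_max !lexx !orbT.
have [] := max3 (qdist x y) (qdist y z) (qdist z w).
set M := Num.max _ _ => /= m1 m2 m3.
have M0 : 0 <= M := le_trans (qdist_ge0 x y) m1.
have le x' y' : qdist x' y' <= M -> phiR x' y' <= M ^+ beta.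
  by move=> H; rewrite -qdistX lerXn2r ?nnegrE ?qdist_ge0.
have le1 := le _ _ m1; have le2 := le _ _ m2; have le3 := le _ _ m3.
have Kp : 0 < quasi_cst a :> R by apply: lt_le_trans K1.
have pq := phi_quasi rho_ge0 rho_sym rho_quasi v_ge0 v_sub vpow.
have yw : phiR y w <= quasi_cst a * M ^+ beta.
  by apply: le_trans (pq y z w) _; rewrite ler_pM2l// ge_max le2.
rewrite -(@ler_pXn2r _ beta)// ?nnegrE ?qdist_ge0 ?mulr_ge0// qdistX exprMn.
apply: le_trans (pq x y w) _.
apply: le_trans (_ : quasi_cst a ^+ 2 * M ^+ beta <= _); last first.
  by rewrite ler_wpM2r ?exprn_ge0// beta_quasi.
rewrite expr2 -mulrA ler_pM2l// ge_max yw andbT; apply: le_trans le1 _.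
by rewrite ler_peMl ?exprn_ge0.
Qed.

Lemma dist_metric : is_metric dist.
Proof. exact: (chain_dist_metric qdist_ge0 qdist_eq0 qdist_sym qdist_quasi). Qed.

Lemma dist_le_qdist x y : dist x y <= qdist x y.
Proof. exact: (chain_dist_le_quasi qdist_ge0). Qed.

Lemma qdist_le_dist x y : qdist x y <= 2 * dist x y.
Proof. exact: (quasi_le_chain_dist qdist_ge0 qdist_eq0 qdist_quasi). Qed.

Lemma dist_ge0 x y : 0 <= dist x y. Proof. by have [] := dist_metric. Qed.
Lemma dist_sym x y : dist x y = dist y x. Proof. by have [_ [_ []]] := dist_metric. Qed.
Lemma dist_triangle x y z : dist x z <= dist x y + dist y z.
Proof. by have [_ [_ []]] := dist_metric. Qed.
Lemma distxx x : dist x x = 0. Proof. by have [_ [/(_ x x)[_ ->]]] := dist_metric. Qed.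

Lemma distX_le x y : dist x y ^+ beta <= phiR x y.
Proof. by rewrite -qdistX lerXn2r ?nnegrE ?dist_ge0 ?qdist_ge0// dist_le_qdist. Qed.

Lemma distX_ge x y : phiR x y <= 2 ^+ beta * dist x y ^+ beta.
Proof.
rewrite -qdistX -exprMn lerXn2r ?nnegrE ?qdist_ge0 ?mulr_ge0 ?dist_ge0//.
exact: qdist_le_dist.
Qed.

Lemma dist_half x y : x != y -> 2^-1 <= dist x y.
Proof.
move=> /phi_ge1; rewrite -qdistX => q1.
have {}q1 : 1 <= qdist x y.
  by rewrite -(@ler_pXn2r _ beta)// ?nnegrE ?qdist_ge0// expr1n.
have := qdist_le_dist x y; lra.
Qed.

(** Along an edge [rho x y <= M0 / muv x], and the ball of radius [1 / muv x] is the point [x];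
    doubling from that radius bounds [phi] by a constant. *)
Lemma dist_edge : exists2 Ce, 1 <= Ce & forall x y, y \in nb x -> dist x y <= Ce.
Proof.
have [M0 M01 HM] := Rmet_edge_p0 Gs Gc Gmu infV Gp0.
pose L : R := 18 ^+ a + 1.
have L1 : 1 <= L by rewrite lerDr exprn_ge0.
pose Ce := L * (M0 * (2 * M0) ^+ a).
have Ce1 : 1 <= Ce.
  by rewrite mulr_ege1// mulr_ege1// exprn_ege1//; lra.
exists Ce => // x y xy.
have i0 : 0 < (muv x)^-1 by rewrite invr_gt0.
have vx : vR x (muv x)^-1 <= muv x.
  apply: (mass_le Gmu); first exact: (vol_fin Gmu fin).
  move=> U uU UB; rewrite -[leRHS](big_seq1 +%R x muv).
  apply: sum_sub_seq => // [z /UB zB|z]; last exact: ltW.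
  rewrite inE eq_sym; apply/negPn/negP => xz; move: zB; rewrite /ball_m/=.
  by rewrite ltNge (Rmet_ge Gs Gc Gmu xz).
have phiC : phiR x y <= Ce.
  apply: le_trans (phi_le rho_ge0 rho_quasi v_sub vpow x y) _.
  rewrite /Ce -/L ler_pM2l; last by lra.
  have ry := HM _ _ xy.
  apply: le_trans (_ : (M0 / muv x) * ((2 * M0) ^+ a * muv x) <= _).
    apply: ler_pM => //.
    apply: le_trans (v_mono v_sub x ry) _.
    apply: le_trans (v_scale vpow x i0 M01) _.
    by rewrite ler_wpM2l// exprn_ge0//; lra.
  rewrite le_eqVlt; apply/orP; left; apply/eqP; field.
  by rewrite gt_eqF.
apply: le_trans (dist_le_qdist x y) _; rewrite leNgt; apply/negP => qC.
have q1 : 1 <= qdist x y by lra.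
have : qdist x y <= qdist x y ^+ beta by rewrite -[leLHS]expr1 ler_weXn2l.
by rewrite qdistX; lra.
Qed.

(** Of two points far apart, one is far from [x] by the quasi-triangle inequality; [phi_mu] and
    [distX_ge] carry this over to [dist]. *)
Lemma dist_unbounded x s : exists y, s <= dist x y.
Proof.
wlog s0 : s / 0 <= s.
  move=> H; have [/H//|/ltW s0] := leP 0 s.
  by exists x; rewrite distxx.
have [u [w uw]] := unb (8 * ((2 * s) ^+ beta / muv x)).
suff [y Hy] : exists y, (2 * s) ^+ beta <= rho x y * muv x.
  exists y; rewrite -(ler_pM2l (ltr0n _ 2)) -(@ler_pXn2r _ beta)//.
  - by apply: le_trans Hy (le_trans (phi_mu x y) _); rewrite exprMn distX_ge.
  - by rewrite nnegrE mulr_ge0.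
  - by rewrite nnegrE mulr_ge0 ?dist_ge0.
have := lt_le_trans uw (rho_quasi u x w); rewrite ltr_pM2l// lt_max rho_sym.
by move=> /orP[] /ltW H; [exists u|exists w]; rewrite -ler_pdivrMr.
Qed.

(** A path from [x] to a far vertex, cut at its first vertex outside the ball. *)
Lemma first_exit x s : 0 < s -> exists n (xs : nat -> V),
  [/\ (1 <= n)%N, xs 0%N = x, forall i, (i < n)%N -> dist x (xs i) < s,
      s <= dist x (xs n) &
      forall i, (1 <= i <= n)%N -> adj nb (xs i.-1) (xs i)].
Proof.
move=> s0; have [y sy] := dist_unbounded x s.
have [p [xp py]] := Gc x y.
pose A z := s <= dist x z.
have hasA : has A (x :: p).
  by apply/hasP; exists y => //; rewrite -py mem_last.
pose n := find A (x :: p).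
have n1 : (1 <= n)%N.
  by rewrite /n /= /A distxx leNgt s0.
exists n, (nth x (x :: p)); split => //.
- by move=> i iln; have := before_find x iln; rewrite /A leNgt => /negbFE.
- exact: (nth_find x hasA).
- move=> i /andP[i1 ile].
  have szn : (n < (size p).+1)%N by rewrite -[(size p).+1]/(size (x :: p)) -has_find.
  move/(pathP x): xp; case: i i1 ile => // i _ ile /(_ i) /=.
  by rewrite /nth; apply; rewrite -ltnS (leq_ltn_trans ile).
Qed.

Definition vd x s := mass (nb := nb) (mu := mu) (ball_m dist x s).

Lemma dist_ball_fin x s : (vol nb mu dist x s < +oo)%E.
Proof.
pose t : R := 2 ^+ beta * `|s| ^+ beta / muv x + 1.
apply: le_lt_trans (vol_fin Gmu fin x t).
apply: (muset_mono Gmu) => z; rewrite /ball_m/= => xz.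
rewrite /t -[ltLHS]addr0 ler_ltD//.
rewrite ler_pdivlMr//; apply: le_trans (phi_mu x z) (le_trans (distX_ge x z) _).
rewrite ler_wpM2l ?exprn_ge0// lerXn2r ?nnegrE ?dist_ge0//.
by apply: le_trans (ltW xz) (ler_norm _).
Qed.

Lemma vol_dist x s : vol nb mu dist x s = (vd x s)%:E.
Proof. exact: (massE Gmu (dist_ball_fin x s)). Qed.

Lemma vd_mono x s t : s <= t -> vd x s <= vd x t.
Proof.
move=> st; apply: (mass_mono Gmu); last exact: dist_ball_fin.
by move=> z; rewrite /ball_m/= => /lt_le_trans; apply.
Qed.

Lemma vd_le_vR x s t : (forall z, dist x z < s -> rho x z < t) -> vd x s <= vR x t.
Proof. by move=> H; apply: (mass_mono Gmu); [move=> z; exact: H|exact: vol_fin]. Qed.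

Lemma vR_le_vd x s t : (forall z, rho x z < t -> dist x z < s) -> vR x t <= vd x s.
Proof. by move=> H; apply: (mass_mono Gmu); [move=> z; exact: H|exact: dist_ball_fin]. Qed.

(** The exit vertex overshoots [s] by at most one edge, of length [Ce <= 2 * Ce * s]. *)
Lemma dist_perfect : exists2 C1, 1 <= C1 &
  forall x s, 2^-1 <= s -> exists y, s <= dist x y <= C1 * s.
Proof.
have [Ce Ce1 He] := dist_edge.
exists (1 + 2 * Ce) => [|x s s2]; first by lra.
have [|n [xs [n1 x0 xlt xn xadj]]] := @first_exit x s; first by lra.
exists (xs n); rewrite xn/=.
have := dist_triangle x (xs n.-1) (xs n).
have : dist x (xs n.-1) < s by apply: xlt; rewrite prednK.
have : dist (xs n.-1) (xs n) <= Ce by apply: He; apply: xadj; rewrite n1 leqnn.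
by nra.
Qed.

Lemma dist_fits : fits nb dist.
Proof.
have [Ce Ce1 He] := dist_edge.
split.
  exists (2 * Ce); split; first by lra.
  move=> x y z xy /eqP /dist_half; have := He _ _ xy; nra.
(* At this radius every edge has length at most [Ce = eps * s]. *)
move=> eps e0; pose s := Ce / eps.
have s0 : 0 < s by rewrite divr_gt0//; lra.
have [x _] := unb 0.
have [n [xs [n1 x0 xlt xn xadj]]] := @first_exit x s s0.
exists s, n, xs; split => //; split => //; split; [|split].
- by move=> i /xlt; rewrite x0.
- by rewrite x0 /ball_m/= => /lt_le_trans/(_ xn); rewrite ltxx.
- move=> i /xadj H; split => //; rewrite dist_sym.
  by rewrite /s mulrC divfK ?gt_eqF//; exact: He.
Qed.

(** [phi] is comparable to [dist ^+ beta] and grows between linearly and like the power [a + 1] in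
    [rho]. This gives the exponent [beta] for ratios above 1 and [beta / (a + 1)] below. *)
Lemma dist_quasisymmetric : quasisymmetric dist rho.
Proof.
pose L : R := 18 ^+ a + 1.
have L1 : 1 <= L by rewrite lerDr exprn_ge0.
have L0 : 0 < L by lra.
pose C := 2 ^+ a * L * 2 ^+ beta.
have p2 k : 1 <= 2 ^+ k :> R by rewrite exprn_ege1//; lra.
have C1 : 1 <= C by rewrite mulr_ege1// mulr_ege1.
have C0 : 0 < C by lra.
pose p : R := beta%:R; pose q : R := beta%:R / a.+1%:R.
have q0 : 0 < q by rewrite divr_gt0// ltr0n.
have qp : q <= p by rewrite ler_pdivrMr ?ltr0n// ler_peMr// ler1n.
exists (gauge C p q); split; first exact: gauge_homeo.
move=> x y z /eqP nxz; set T := dist x y / dist x z; set X := rho x y / rho x z.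
have rz : 0 < rho x z by exact: (Rmet_gt0 Gs Gc Gmu).
have dz : 0 < dist x z by have := dist_half nxz; lra.
have T0 : 0 <= T by rewrite divr_ge0 ?dist_ge0.
have X0 : 0 <= X by rewrite divr_ge0.
have yX : rho x y = X * rho x z by rewrite divfK// gt_eqF.
have phiz : 0 < phiR x z by have := phi_ge1 nxz; lra.
have phiT : phiR x y <= 2 ^+ beta * T ^+ beta * phiR x z.
  apply: le_trans (distX_ge x y) _; rewrite -mulrA ler_pM2l ?exprn_gt0//.
  rewrite /T expr_div_n -mulrA ler_peMr ?exprn_ge0 ?dist_ge0//.
  by rewrite ler_pdivlMl ?exprn_gt0// mulr1 distX_le.
rewrite /gauge ger0_norm//.
have [X1|/ltW X1] := leP X 1.
  apply: le_trans (_ : C * T `^ q <= _); last first.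
    by rewrite ler_pM2l// le_max lexx orbT.
  have [X00|Xn0] := eqVneq X 0; first by rewrite X00 mulr_ge0 ?powR_ge0// ltW.
  have {}Xn0 : 0 < X by rewrite lt_neqAle eq_sym Xn0.
  have := phi_near rho_ge0 rho_quasi v_ge0 v_sub vpow Xn0 X1 yX; rewrite -/L => near.
  have XT : X ^+ a.+1 <= C * T ^+ beta.
    rewrite -(ler_pM2r phiz); apply: le_trans near _.
    rewrite /C -!mulrA ler_pM2l ?exprn_gt0// ler_pM2l//.
    by apply: le_trans phiT _; rewrite -!mulrA.
  have CT0 : 0 <= C * T `^ q by rewrite mulr_ge0 ?powR_ge0// ltW.
  rewrite -(@ler_pXn2r _ a.+1) ?nnegrE//.
  apply: le_trans XT _; rewrite [(C * _) ^+ _]exprMn.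
  have -> : (T `^ q) ^+ a.+1 = T ^+ beta.
    by rewrite -powR_mulrn ?powR_ge0// -powRrM /q divfK ?pnatr_eq0// powR_mulrn.
  by rewrite ler_wpM2r ?exprn_ge0// -[leLHS]expr1 ler_weXn2l.
apply: le_trans (_ : C * T `^ p <= _); last by rewrite ler_pM2l// le_max lexx.
rewrite /p powR_mulrn//.
have zy : rho x z <= rho x y by rewrite yX ler_peMl.
have := phi_far rho_ge0 rho_quasi v_ge0 v_sub vpow X0 zy; rewrite -yX lexx => /(_ isT).
rewrite -/L => far; rewrite -(ler_pM2r phiz); apply: le_trans far _.
set Y := 2 ^+ beta * T ^+ beta * phiR x z in phiT.
have Y0 : 0 <= Y := le_trans (phi0 x y) phiT.
apply: le_trans (_ : L * Y <= _); first by rewrite ler_pM2l.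
apply: le_trans (_ : 2 ^+ a * (L * Y) <= _).
  by rewrite ler_peMl// mulr_ge0// ltW.
by rewrite /C /Y !mulrA.
Qed.

Lemma dist_scale : exists2 A, 1 <= A &
  forall x s, 2^-1 <= s -> exists y, scale rho vR dist beta vd A x s y.
Proof.
have [C1 C11 perf] := dist_perfect.
exact: (scaleP rho_ge0 rho_quasi v_ge0 v_gt0 v_sub vpow dist_ge0 distX_le distX_ge
  vd_le_vR vR_le_vd C11 perf).
Qed.

Lemma dist_growth : exists2 C : R, 0 < C & forall x s t, 2^-1 <= t -> t <= s ->
  vd x s ^+ a.+1 <= C * (s / t) ^+ (a * beta) * vd x t ^+ a.+1.
Proof.
have [C1 C11 perf] := dist_perfect.
exact: (volume_growth rho_ge0 rho_quasi v_ge0 v_gt0 v_sub vpow dist_ge0 distX_le distX_ge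
  vd_le_vR vR_le_vd C11 perf).
Qed.

Lemma vd_ge0 x s : 0 <= vd x s. Proof. exact: mass_ge0. Qed.

Lemma vd_gt0 x s : 0 < s -> 0 < vd x s.
Proof.
move=> s0; apply: lt_le_trans (mu0 x) _.
have := @le_mass_sum R V nb mu Gmu (ball_m dist x s) [:: x] (dist_ball_fin x s) isT.
rewrite big_seq1; apply => y; rewrite inE => /eqP ->.
by rewrite /ball_m/= distxx.
Qed.

Lemma rmin_dist x s : rmin dist x < s -> 2^-1 < s.
Proof.
apply: le_lt_trans; apply: lb_le_inf.
  have [y /eqP nyx] : exists y, y <> x.
    apply: contrapT => H; apply: infV; apply: (@sub_finite_set _ _ [set x]) => //.
    by move=> y _; apply: contrapT => yx; apply: H; exists y.
  by exists (dist x y), y.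
by move=> _ [y /= yx <-]; apply: dist_half; rewrite eq_sym.
Qed.

Lemma powR_beta (s : R) : 0 <= s -> s `^ beta%:R = s ^+ beta.
Proof. by move=> s0; rewrite powR_mulrn. Qed.

(** The witness [y] of [scale] lies outside the ball, so the resistance from [x] to the complement
    is at most [rho x y]. *)
Lemma dist_BRU : exists C' : R, 0 < C' /\
  forall (x : V) (s : R), rmin dist x < s ->
  (effres nb mu [set x] (~` ball_m dist x s) * vol nb mu dist x s <=
    (C' * s `^ beta%:R)%:E)%E.
Proof.
have [A A1 HA] := dist_scale.
exists (A * A); split; first by rewrite mulr_gt0//; lra.
move=> x s /rmin_dist s2; have s0 : 0 < s by lra.
have [y [r0 sy _ _ [_ vA _ rA]]] := HA x s (ltW s2).
have nxy : x != y by apply/eqP => xy; move: r0; rewrite xy Rmetxx ltxx.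
apply: le_trans (_ : (rho x y)%:E * (vd x s)%:E <= _)%E.
  rewrite vol_dist lee_wpmul2r ?lee_fin ?vd_ge0//.
  rewrite -(effresE Gs Gc Gmu nxy); apply: (effres_anti Gmu) => z ->.
  by rewrite /ball_m/=; apply/negP; rewrite -leNgt.
rewrite -EFinM lee_fin powR_beta ?(ltW s0)//.
apply: le_trans (ler_wpM2l (ltW r0) vA) _; rewrite mulrCA -mulrA ler_wpM2l//; lra.
Qed.

(** The cutoff of resistance radius [r / A] vanishes off the [dist]-ball of radius [s]; [small_ball]
    provides an inner ball on which it equals 1. *)
Lemma dist_ARL : exists lam C : R, 0 < lam /\ 0 < C /\
  forall (x : V) (s : R), rmin dist x < s ->
  ((C * s `^ beta%:R)%:E <=
    effres nb mu (ball_m dist x (lam * s)) (~` ball_m dist x s) * vol nb mu dist x s)%E.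
Proof.
have [A A1 HA] := dist_scale; have A0 : 0 < A by lra.
have [lam [Cc [lam0 lam1 Cc0 Hcut]]] := cutoff Gs Gc Gmu infV fin vpow Gp0.
have c0 : 0 < lam / A by rewrite divr_gt0.
have c1 : lam / A <= 1 by rewrite ler_pdivrMr// mul1r; lra.
have [lam' lam'0 Hlam'] := small_ball rho_ge0 v_ge0 v_sub vpow vd (isT : (0 < beta)%N)
  dist_ge0 distX_ge A1 c0 c1.
exists lam', (A ^+ 3 * Cc)^-1; split => //; split.
  by rewrite invr_gt0 mulr_gt0// exprn_gt0.
move=> x s /rmin_dist s2; have s0 : 0 < s by lra.
have [y sc] := HA x s (ltW s2).
have Hz := Hlam' x s y s0 sc.
case: sc => r0 _ _ far [vA _ sA _]; set r := rho x y in r0 Hz far vA sA.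
have rA0 : 0 < r / A by rewrite divr_gt0.
have [g [g0 g1 gin gout Eg]] := Hcut x (r / A) rA0.
have Cr0 : 0 < Cc / (r / A) by rewrite divr_gt0.
have H : (((Cc / (r / A))^-1)%:E <=
    effres nb mu (ball_m dist x (lam' * s)) (~` ball_m dist x s))%E.
  apply: (effres_ge Gmu Cr0 _ _ Eg) => z; rewrite /ball_m/=.
    by move=> /Hz; rewrite mulrAC => zr; apply: gin; rewrite mulrA.
  move=> /negP; rewrite -leNgt => sz; apply: gout; rewrite leNgt; apply/negP => zr.
  have : dist x z < s by apply: far; move: zr; rewrite ltr_pdivlMr// mulrC.
  by rewrite ltNge sz.
rewrite vol_dist; apply: le_trans (lee_wpmul2r _ H); last by rewrite lee_fin vd_ge0.
rewrite -EFinM lee_fin powR_beta ?(ltW s0)// ler_pdivrMl ?mulr_gt0 ?exprn_gt0//.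
apply: le_trans sA _.
have -> : A ^+ 3 * Cc * ((Cc / (r / A))^-1 * vd x s) = A * (r * (A * vd x s)).
  by field; rewrite !gt_eqF.
by rewrite ler_pM2l// ler_pM2l.
Qed.

(** [dist_growth] covers radii from 1/2 on; below that balls are single points. *)
Lemma dist_VG : exists C'' : R, 0 < C'' /\ forall (x : V) (s t : R), 0 < t -> t < s ->
  (vol nb mu dist x s <=
    (C'' * (s / t) `^ ((a * beta)%:R / a.+1%:R))%:E * vol nb mu dist x t)%E.
Proof.
have [C C0 HC] := dist_growth.
set al : R := (a * beta)%:R / a.+1%:R.
have al0 : 0 <= al by rewrite divr_ge0.
exists (C + 1); split; first by lra.
have large x s t : 2^-1 <= t -> t <= s -> vd x s <= (C + 1) * (s / t) `^ al * vd x t.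
  move=> t2 ts; have t0 : 0 < t by lra.
  have st0 : 0 <= s / t by rewrite divr_ge0 ?(ltW t0)// (le_trans (ltW t0)).
  have B0 : 0 <= (C + 1) * (s / t) `^ al by rewrite mulr_ge0 ?powR_ge0//; lra.
  rewrite -(@ler_pXn2r _ a.+1)// ?nnegrE ?vd_ge0//; last by rewrite mulr_ge0// vd_ge0.
  apply: le_trans (HC x s t t2 ts) _; rewrite !exprMn.
  have -> : ((s / t) `^ al) ^+ a.+1 = (s / t) ^+ (a * beta).
    rewrite -powR_mulrn ?powR_ge0// -powRrM /al divfK ?pnatr_eq0//.
    by rewrite powR_mulrn.
  rewrite -exprMn ler_wpM2r ?exprn_ge0 ?vd_ge0// ler_wpM2r ?exprn_ge0//.
  apply: le_trans (_ : C + 1 <= _); first by lra.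
  by rewrite -[leLHS]expr1 ler_weXn2l//; lra.
move=> x s t t0 ts; rewrite !vol_dist -EFinM lee_fin.
have s0 : 0 < s by lra.
have [t2|/ltW t2] := leP 2^-1 t; first by apply: large => //; exact: ltW.
have [s2|/ltW s2] := leP s 2^-1.
  apply: le_trans (_ : 1 * vd x t <= _).
    rewrite mul1r; apply: (mass_mono Gmu); last exact: dist_ball_fin.
    move=> z; rewrite /ball_m/= => zs; have [<-|/dist_half] := eqVneq x z; first by rewrite distxx.
    by lra.
  rewrite ler_wpM2r ?vd_ge0//.
  have : 1 <= (s / t) `^ al by rewrite powR_ge1// ler_pdivlMr// mul1r ltW.
  by nra.
(* For [t <= 1/2 <= s] the balls of radii [t] and 1/2 coincide, while [s / (1/2) <= s / t]. *)
apply: le_trans (large x s 2^-1 (lexx _) s2) _.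
have i2 : (0 : R) < 2^-1 by rewrite invr_gt0.
apply: ler_pM; rewrite ?vd_ge0//.
- by rewrite mulr_ge0 ?powR_ge0//; lra.
- rewrite ler_pM2l; last by lra.
  apply: ge0_ler_powR; rewrite ?nnegrE ?divr_ge0 ?(ltW s0) ?(ltW t0) ?(ltW i2)//.
  by rewrite ler_pM2l// lef_pV2.
- apply: (mass_mono Gmu); last exact: dist_ball_fin.
  move=> z; rewrite /ball_m/= => zs; have [<-|/dist_half] := eqVneq x z; first by rewrite distxx.
  by lra.
Qed.

Let W x k := vd x (k%:R `^ beta%:R^-1).

Let root_ge1 k : (0 < k)%N -> 1 <= k%:R `^ beta%:R^-1 :> R.
Proof. by move=> k0; rewrite powR_ge1 ?invr_ge0// ler1n. Qed.

Let rootX k : (k%:R `^ beta%:R^-1) ^+ beta = k%:R :> R.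
Proof. exact: powR_invn. Qed.

(** At radius [k ^ (1 / beta)] the relation in [scale] reads [k ~ r * vR x r], as both kernel bounds
    require. *)
Lemma dist_HK : exists c1 c2 : R, 0 < c1 /\ 0 < c2 /\
  forall (x : V) (n : nat), (1 <= n)%N ->
  (c1%:E * (vol nb mu dist x (n%:R `^ beta%:R^-1))^-1 <= (hk nb mu n.*2 x x)%:E)%E /\
  ((hk nb mu n.*2 x x)%:E <= c2%:E * (vol nb mu dist x (n%:R `^ beta%:R^-1))^-1)%E.
Proof.
have [A A1 HA] := dist_scale; have A0 : 0 < A by lra.
have [D D0 HD] := dist_growth.
have Wscale x k : (0 < k)%N -> exists r,
  [/\ 0 < r, k%:R <= A * (r * vR x r), r * vR x r <= A * k%:R,
      vR x r <= A * W x k & W x k <= A * vR x r].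
  move=> k0; have [|y [r0 _ _ _ []]] := HA x (k%:R `^ beta%:R^-1).
    by have := root_ge1 k0; lra.
  by rewrite rootX => ? ? ? ?; exists (rho x y).
have Wgrowth x k n : (0 < k)%N -> (k <= n)%N ->
  W x n ^+ a.+1 <= D * (n%:R / k%:R) ^+ a * W x k ^+ a.+1.
  move=> k0 kn; have := HD x (n%:R `^ beta%:R^-1) (k%:R `^ beta%:R^-1).
  rewrite mulnC exprM [(_ / _) ^+ beta]expr_div_n !rootX; apply.
    by have := root_ge1 k0; lra.
  by apply: ge0_ler_powR; rewrite ?nnegrE ?invr_ge0 ?ler_nat.
have [C2 C21 Hup] := c_upper Gs Gc Gmu infV fin A1 Wscale.
have [C1 C10 Hlow] := h_lower_bound Gs Gc Gmu infV fin vpow Gp0 A1 D0 Wscale Wgrowth.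
exists C1, C2; split => //; split; first by lra.
move=> x n n1.
have Wn0 : 0 < W x n by apply: vd_gt0; have := root_ge1 n1; lra.
rewrite vol_dist inver gt_eqF// -!EFinM !lee_fin; split; first exact: Hlow.
have hc : hk nb mu n.*2 x x <= hkpair (nb := nb) (mu := mu) x n.
  by rewrite /hkpair lerDl; exact: (h_ge0 Gmu mu0).
apply: le_trans hc _; apply: le_trans (Hup x n) _.
rewrite ler_pM2l; last by lra.
have WS : W x n <= W x n.+1.
  by apply: vd_mono; apply: ge0_ler_powR; rewrite ?nnegrE ?invr_ge0 ?ler_nat.
by rewrite lef_pV2// posrE (lt_le_trans Wn0).
Qed.

End ResistanceDistance.

Unset Implicit Arguments.

Theorem theorem4p3 (R : realType) (V : countType) (nb : V -> seq V) (mu : V -> V -> R) :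
  infinite_set [set: V] ->
  simple_graph nb -> connected_graph nb -> bounded_degree nb ->
  conductance nb mu ->
  cond_p0 nb mu ->
  VD nb mu (Rmet nb mu) ->
  (forall M : R, exists x y : V, M < Rmet nb mu x y) ->
  (forall (x : V) (s : R), 0 < s -> (vol nb mu (Rmet nb mu) x s < +oo)%E) ->
  exists (d : V -> V -> R) (alpha beta : R),
    is_metric d /\ fits nb d /\ quasisymmetric d (Rmet nb mu) /\
    (exists c1 c2 : R, 0 < c1 /\ 0 < c2 /\
       forall x y, adj nb x y -> c1 <= d x y <= c2) /\
    1 <= alpha /\ alpha < beta /\
    (* DHK(beta) *)
    (exists c1 c2 : R, 0 < c1 /\ 0 < c2 /\
       forall (x : V) (n : nat), (1 <= n)%N ->
         (c1%:E * (vol nb mu d x (n%:R `^ beta^-1))^-1 <= (hk nb mu n.*2 x x)%:E)%E /\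
         ((hk nb mu n.*2 x x)%:E <= c2%:E * (vol nb mu d x (n%:R `^ beta^-1))^-1)%E) /\
    (* ARL(beta) *)
    (exists lam C : R, 0 < lam /\ 0 < C /\
       forall (x : V) (s : R), rmin d x < s ->
         ((C * s `^ beta)%:E <=
            effres nb mu (ball_m d x (lam * s)) (~` ball_m d x s) * vol nb mu d x s)%E) /\
    (* BRU(beta) *)
    (exists C' : R, 0 < C' /\
       forall (x : V) (s : R), rmin d x < s ->
         (effres nb mu [set x] (~` ball_m d x s) * vol nb mu d x s <= (C' * s `^ beta)%:E)%E) /\
    (* VG(alpha) *)
    (exists C'' : R, 0 < C'' /\
       forall (x : V) (s t : R), 0 < t -> t < s ->
         (vol nb mu d x s <= (C'' * (s / t) `^ alpha)%:E * vol nb mu d x t)%E).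

Proof.
move=> infV Gs Gc _ Gmu Gp0 Gvd unb fin.
have [a a0 vpow] := vR_pow Gmu fin Gvd.
exists (dist (nb := nb) (mu := mu) a), ((a * beta (R := R) a)%:R / a.+1%:R), (beta (R := R) a)%:R.
split; first exact: (dist_metric Gs Gc Gmu infV fin vpow).
split; first exact: (dist_fits Gs Gc Gmu infV Gp0 fin unb vpow).
split; first exact: (dist_quasisymmetric Gs Gc Gmu infV fin vpow).
split.
  have [Ce Ce1 He] := dist_edge Gs Gc Gmu infV Gp0 fin vpow.
  exists 2^-1, Ce; split; first by rewrite invr_gt0.
  split=> [|x y xy]; first by rewrite (lt_le_trans ltr01).
  rewrite (He _ _ xy) andbT; apply: (dist_half Gs Gc Gmu infV fin vpow).
  by apply/eqP => e; move: (Gs.2.1 x); rewrite {1}e; move: xy; rewrite /adj => ->.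
split.
  (* [a + 1 <= a * beta], because [beta >= 2] by its definition and [a >= 1]. *)
  rewrite ler_pdivlMr ?ltr0n// mul1r ler_nat /beta.
  by rewrite mulnS mulnS addnA (leq_trans _ (leq_addr _ _))// addnn -addn1 -mul2n; lia.
split.
  rewrite ltr_pdivrMr ?ltr0n// -natrM ltr_nat mulnC ltn_pmul2l//.
split; first exact: (dist_HK Gs Gc Gmu infV Gp0 fin unb vpow).
split; first exact: (dist_ARL Gs Gc Gmu infV Gp0 fin unb vpow).
split; first exact: (dist_BRU Gs Gc Gmu infV Gp0 fin unb vpow).
exact: (dist_VG Gs Gc Gmu infV Gp0 fin unb vpow).
Qed.
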